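(* Let $n\geq 2$ be an integer and $\kappa\geq 0$. Assume the metric measure space $(X^n,d,\mu)$ satisfies the $n$-dimensional condition and the curvature-dimension condition ${\rm CD}(\kappa,n)$. Then ${\rm Sc}^{{\rm vol}_n}(X^n)\geq n\kappa$ (for $\kappa=0$ this means ${\rm Sc}^{{\rm vol}_n}(X^n)\geq 0$).
   Context: A metric measure space (mm-space) $(X,d,\mu)$ consists of a complete separable length metric $d$ on $X$ and a locally finite Borel measure $\mu$ of full support. ${\rm CD}(\kappa,n)$ is the Lott--Sturm--Villani curvature-dimension condition (in Sturm's formulation). $B_r(x)$ denotes the closed $r$-ball about $x$ and ${\rm vol}_E(B_r(\mathbf{R}^n))$ the Euclidean volume of a closed $r$-ball in $\mathbf{R}^n$. The $n$-dimensional condition: $\lim_{r\to 0}\mu(B_r(x))/{\rm vol}_E(B_r(\mathbf{R}^n))=1$ for every $x\in X$. For $\gamma>0$ let $S^2(\gamma)$ be the round 2-sphere with scalar curvature $2\gamma^{-2}$, and let $S^2(\gamma)\times\mathbf{R}^{n-2}$ carry the product metric $\sqrt{d_S^2+d_E^2}$ and product volume measure; its $\epsilon$-balls all have the same volume ${\rm vol}_{S\times E}(B_\epsilon(S^2(\gamma)\times\mathbf{R}^{n-2}))$. For an mm-space $X$ satisfying the $n$-dimensional condition: ${\rm Sc}^{{\rm vol}_n}(X)\geq 0$ means there is $r>0$ with $\mu(B_\epsilon(x))\leq{\rm vol}_E(B_\epsilon(\mathbf{R}^n))$ for all $x\in X$ and $0<\epsilon\leq r$; for $K>0$, ${\rm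 Sc}^{{\rm vol}_n}(X)\geq K$ means that for every $\gamma>\sqrt{2/K}$ there is $r_\gamma>0$ with $\mu(B_\epsilon(x))<{\rm vol}_{S\times E}(B_\epsilon(S^2(\gamma)\times\mathbf{R}^{n-2}))$ for all $x\in X$ and $0<\epsilon\leq r_\gamma$. *)

(* Defs.v *)
From HB Require Import structures.
From mathcomp Require Import all_boot all_order all_algebra.
From mathcomp Require Import all_classical all_reals all_analysis.
Set Implicit Arguments. Unset Strict Implicit. Unset Printing Implicit Defensive.
Import Order.TTheory GRing.Theory Num.Theory.
Import numFieldNormedType.Exports.
Local Open Scope classical_set_scope.
Local Open Scope ring_scope.

Definition is_metric {R : realType} {X : Type} (d : X -> X -> R) : Prop :=
  [/\ (forall x y, 0 <= d x y),
      (forall x y, d x y = 0 <-> x = y),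
      (forall x y, d x y = d y x) &
      (forall x y z, d x z <= d x y + d y z)].

Definition cball {R : realType} {X : Type} (d : X -> X -> R) (x : X) (r : R)
  : set X := [set y | d x y <= r].

Definition oball {R : realType} {X : Type} (d : X -> X -> R) (x : X) (r : R)
  : set X := [set y | d x y < r].

Definition d_open {R : realType} {X : Type} (d : X -> X -> R) (A : set X) : Prop :=
  forall x, A x -> exists2 e : R, 0 < e & oball d x e `<=` A.

Definition d_complete {R : realType} {X : Type} (d : X -> X -> R) : Prop :=
  forall u : nat -> X,
    (forall e : R, 0 < e -> exists N : nat, forall m k : nat,
        (N <= m)%N -> (N <= k)%N -> d (u m) (u k) < e) ->
    exists l : X, forall e : R, 0 < e -> exists N : nat, forall k : nat,
        (N <= k)%N -> d (u k) l < e.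

Definition d_separable {R : realType} {X : Type} (d : X -> X -> R) : Prop :=
  exists D : set X, countable D /\
    forall (x : X) (e : R), 0 < e -> exists2 y, D y & d x y < e.

Definition d_curve_continuous {R : realType} {X : Type} (d : X -> X -> R)
  (c : R -> X) : Prop :=
  forall t : R, 0 <= t <= 1 -> forall e : R, 0 < e ->
    exists2 delta : R, 0 < delta &
      forall s : R, 0 <= s <= 1 -> `|s - t| < delta -> d (c s) (c t) < e.

Definition curve_length {R : realType} {X : Type} (d : X -> X -> R)
  (c : R -> X) : \bar R :=
  ereal_sup [set v : \bar R | exists (k : nat) (p : nat -> R),
      [/\ p 0%N = 0, p k = 1, (forall i : nat, p i <= p i.+1) &
          v = (\sum_(i < k) d (c (p i)) (c (p i.+1)))%:E]].

Definition d_length {R : realType} {X : Type} (d : X -> X -> R) : Prop :=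
  forall x y : X,
    (d x y)%:E = ereal_inf [set curve_length d c | c in
       [set c : R -> X | d_curve_continuous d c /\ c 0 = x /\ c 1 = y]].

Definition mm_space {dX : measure_display} {X : measurableType dX}
  {R : realType} (d : X -> X -> R) (mu : {measure set X -> \bar R}) : Prop :=
  [/\ is_metric d, d_complete d, d_separable d, d_length d &
      [/\
      (@measurable _ X : set (set X)) = <<s [set A | d_open d A] >>,
      (forall x : X, exists2 r : R, 0 < r & (mu (oball d x r) < +oo)%E) &
      (forall (x : X) (r : R), 0 < r -> (0 < mu (oball d x r))%E)]].

(* omega k = Euclidean volume of the unit ball of R^k:
   omega 0 = 1, omega 1 = 2, omega (k+2) = 2 pi / (k+2) * omega k *)
Fixpoint omega {R : realType} (k : nat) : R :=
  match k with
  | 0%N => 1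
  | 1%N => 2
  | (k'.+2)%N => (2 * pi / (k'.+2)%:R) * omega k'
  end.

Definition volE {R : realType} (n : nat) (r : R) : R := omega n * r ^+ n.

(* volume of an eps-ball in S^2(gamma) x R^(n-2) (S^2(gamma) = round sphere
   of radius gamma, i.e. scalar curvature 2/gamma^2), computed by
   integrating, over the geodesic distance s to the centre on the sphere
   (area element 2 pi gamma sin(s/gamma) ds), the volume of the Euclidean
   (n-2)-ball of radius sqrt(eps^2 - s^2). *)
Definition volSE {R : realType} (n : nat) (gamma eps : R) : \bar R :=
  (\int[@lebesgue_measure R]_(s in [set s : R | (0 <= s <= Num.min eps (pi * gamma))%R])
     ((2 * pi * gamma * sin (s / gamma)) * omega (n - 2)
        * ((eps ^+ 2 - s ^+ 2) `^ ((n - 2)%:R / 2)))%R%:E)%E.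

Definition n_dimensional {dX : measure_display} {X : measurableType dX}
  {R : realType} (n : nat) (d : X -> X -> R) (mu : {measure set X -> \bar R})
  : Prop :=
  forall x : X,
    (fun r : R => fine (mu (cball d x r)) / volE n r) @ 0^'+ --> (1 : R).

Definition Sc_vol_ge0 {dX : measure_display} {X : measurableType dX}
  {R : realType} (n : nat) (d : X -> X -> R) (mu : {measure set X -> \bar R})
  : Prop :=
  exists2 r : R, 0 < r &
    forall (x : X) (eps : R), 0 < eps <= r ->
      (mu (cball d x eps) <= (volE n eps)%:E)%E.

Definition Sc_vol_gtK {dX : measure_display} {X : measurableType dX}
  {R : realType} (n : nat) (d : X -> X -> R) (mu : {measure set X -> \bar R})
  (K : R) : Prop :=
  forall gamma : R, Num.sqrt (2 / K) < gamma ->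
    exists2 r : R, 0 < r &
      forall (x : X) (eps : R), 0 < eps <= r ->
        (mu (cball d x eps) < volSE n gamma eps)%E.

Definition Sc_vol_ge {dX : measure_display} {X : measurableType dX}
  {R : realType} (n : nat) (d : X -> X -> R) (mu : {measure set X -> \bar R})
  (K : R) : Prop :=
  (K = 0 -> Sc_vol_ge0 n d mu) /\ (0 < K -> Sc_vol_gtK n d mu K).

Definition sinhR {R : realType} (a : R) : R := (expR a - expR (- a)) / 2.

Definition sigmaKN {R : realType} (K N theta t : R) : \bar R :=
  let a := K * theta ^+ 2 in
  if N * pi ^+ 2 <= a then +oo%E
  else if 0 < a then
    (sin (t * theta * Num.sqrt (K / N)) / sin (theta * Num.sqrt (K / N)))%:E
  else if a == 0 then t%:E
  else (sinhR (t * theta * Num.sqrt (- K / N)) /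
        sinhR (theta * Num.sqrt (- K / N)))%:E.

Definition tauKN {R : realType} (K N theta t : R) : \bar R :=
  match sigmaKN K (N - 1) theta t with
  | EFin s => (t `^ N^-1 * s `^ (1 - N^-1))%:E
  | _ => ((t `^ N^-1)%:E * +oo)%E
  end.

Definition finite_second_moment {dX : measure_display} {X : measurableType dX}
  {R : realType} (d : X -> X -> R) (nu : probability X R) : Prop :=
  exists x0 : X, (\int[nu]_x ((d x0 x) ^+ 2)%:E < +oo)%E.

Definition is_coupling {dX : measure_display} {X : measurableType dX}
  {R : realType} (nu0 nu1 : probability X R) (q : probability (X * X)%type R)
  : Prop :=
  forall A : set X, measurable A ->
    q (A `*` setT) = nu0 A /\ q (setT `*` A) = nu1 A.

Definition W2sq {dX : measure_display} {X : measurableType dX}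
  {R : realType} (d : X -> X -> R) (nu0 nu1 : probability X R) : \bar R :=
  ereal_inf [set (\int[q]_z ((d z.1 z.2) ^+ 2)%:E)%E | q in
             [set q : probability (X * X)%type R | is_coupling nu0 nu1 q]].

(* S_N(nu | mu) <= c, where S_N(nu|mu) = - \int rho^{1-1/N} dmu and rho is
   the density of the mu-absolutely continuous part of nu *)
Definition renyi_le {dX : measure_display} {X : measurableType dX}
  {R : realType} (mu : {measure set X -> \bar R}) (N : R)
  (nu : probability X R) (c : \bar R) : Prop :=
  forall (rho : X -> R) (nus : {measure set X -> \bar R}),
    measurable_fun setT rho -> (forall x, 0 <= rho x) ->
    (exists Z : set X, [/\ measurable Z, mu Z = 0%E & nus (~` Z) = 0%E]) ->
    (forall A : set X, measurable A ->
       nu A = (\int[mu]_(x in A) (rho x)%:E + nus A)%E) ->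
    (- (\int[mu]_x ((rho x) `^ (1 - N^-1))%:E) <= c)%E.

Definition has_density {dX : measure_display} {X : measurableType dX}
  {R : realType} (mu : {measure set X -> \bar R}) (nu : probability X R)
  (rho : X -> R) : Prop :=
  [/\ measurable_fun setT rho, (forall x, 0 <= rho x) &
      forall A : set X, measurable A -> nu A = (\int[mu]_(x in A) (rho x)%:E)%E].

Definition CD {dX : measure_display} {X : measurableType dX}
  {R : realType} (d : X -> X -> R) (mu : {measure set X -> \bar R}) (K N : R)
  : Prop :=
  forall (nu0 nu1 : probability X R) (rho0 rho1 : X -> R),
    has_density mu nu0 rho0 -> has_density mu nu1 rho1 ->
    finite_second_moment d nu0 -> finite_second_moment d nu1 ->
    exists (q : probability (X * X)%type R) (G : R -> probability X R),
      [/\ is_coupling nu0 nu1 q,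
          (\int[q]_z ((d z.1 z.2) ^+ 2)%:E)%E = W2sq d nu0 nu1,
          [/\ (forall A, measurable A -> G 0 A = nu0 A /\ G 1 A = nu1 A),
           (forall t, 0 <= t <= 1 -> finite_second_moment d (G t))
          & (forall s t, 0 <= s <= 1 -> 0 <= t <= 1 ->
              (W2sq d (G s) (G t) = ((s - t) ^+ 2)%:E * W2sq d nu0 nu1)%E)] &
          forall t N', 0 <= t <= 1 -> N <= N' ->
            renyi_le mu N' (G t)
              (- \int[q]_z (tauKN K N' (d z.1 z.2) (1 - t)
                              * ((rho0 z.1) `^ (- N'^-1))%:E
                            + tauKN K N' (d z.1 z.2) t
                              * ((rho1 z.2) `^ (- N'^-1))%:E))%E].

(* Main.v *)
Require Import Defs.
From HB Require Import structures.
From mathcomp Require Import all_boot all_order all_algebra.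
From mathcomp Require Import all_classical all_reals all_analysis.
From mathcomp Require Import measurable_realfun ring lra.
Set Implicit Arguments. Unset Strict Implicit. Unset Printing Implicit Defensive.
Import Order.TTheory GRing.Theory Num.Theory.
Import numFieldNormedType.Exports.
Local Open Scope classical_set_scope.
Local Open Scope ring_scope.

(** Fix a point [x], transport the normalised measure of a tiny ball
[B_delta(x)] to a probability [nu1] on [A `<=` B_r(x)], and read CD(kappa, n) at
a small time [t]. The interpolating measure lives on [B_(t r + O(delta))(x)], so
by Jensen its Renyi functional is at most [mu (B_(t r + O(delta))(x)) ^ (1/n)],
while the distortion coefficients satisfy
[tau^(t)(theta) >= t (1 - t^2) (1 + kappa theta^2 / 6) ^ (1/n)]. Taking the
density of [nu1] proportional to the weight [1 + kappa d(x, .)^2 / 6] makes the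
lower bound constant, and letting [t -> 0] with [delta = t^2], the
n-dimensional condition gives the weighted Bishop inequality
[int_(B_r(x)) (1 + kappa d(x, y)^2 / 6) dmu(y) <= omega_n r^n].
With the layer cake formula and [mu (B_u(x)) <= omega_n u^n] this becomes
[mu (B_r(x)) (1 + kappa r^2/6) <= omega_n r^n (1 + kappa r^2 / (3 (n + 2)))].
On the other side [sin u >= u - u^3/6] gives
[volSE n gamma r >= omega_n r^n (1 - r^2 / (3 gamma^2 (n + 2)))], and the second
order terms compare strictly exactly when [2 / gamma^2 < n kappa].

That the interpolating measure [nt] is concentrated near the [t]-intermediate
points is shown without disintegration: near-optimal couplings of [(nu0, nt)] and
[(nt, nu1)] are glued, up to an error [e], along a countable partition of [X] into
pieces of diameter at most [e]. *)

(** * Trigonometric and distortion estimates *)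

(** By the mean value theorem on the segment from 0 to [x]. Applied repeatedly, it lifts a sign from
    a derivative to the function and yields the Taylor bounds of sine and cosine below. *)
Lemma nonneg_of_derive (R : realType) (f df : R -> R) :
  (forall x : R, is_derive x 1 f (df x)) -> f 0 = 0 ->
  (forall x, 0 <= x -> 0 <= df x) -> forall x, 0 <= x -> 0 <= f x.
Proof.
move=> fdf f0 df0 x x0.
have [|c] := @MVT_segment R f df 0 x x0 (fun y _ => fdf y).
  apply: derivable_within_continuous => y _; exact: (@ex_derive _ _ _ _ _ _ _ (fdf y)).
rewrite in_itv/= => /andP[c0 _]; rewrite f0 !subr0 => ->.
by rewrite mulr_ge0// df0.
Qed.

(** Three integrations starting from [cos <= 1]: this gives [sin y <= y], then [cos y >= 1 - y^2/2],
    then the cubic bound. *)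
Lemma sin_ge_cubic (R : realType) (x : R) : 0 <= x -> x - x ^+ 3 / 6 <= sin x.
Proof.
have s1 (y : R) : 0 <= y -> 0 <= y - sin y.
  apply: (@nonneg_of_derive _ (fun y => y - sin y) (fun y => 1 - cos y)).
  - by rewrite sin0 subr0.
  - by move=> z _; rewrite subr_ge0 cos_le1.
have c1 (y : R) : 0 <= y -> 0 <= cos y - (1 - y ^+ 2 / 2).
  apply: (@nonneg_of_derive _ (fun y => cos y - (1 - y ^+ 2 / 2)) (fun y => y - sin y)).
  - move=> z; apply: is_derive_eq; rewrite !scaler1 /GRing.scale/=; by field.
  - by rewrite cos0; field.
  - exact: s1.
move=> x0; rewrite -subr_ge0; move: x x0.
apply: (@nonneg_of_derive _ (fun x => sin x - (x - x ^+ 3 / 6))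
  (fun y => cos y - (1 - y ^+ 2 / 2))).
- move=> z; apply: is_derive_eq; rewrite !scaler1 /GRing.scale/=; by field.
- by rewrite sin0; field.
- exact: c1.
Qed.

Lemma sin_le_quintic (R : realType) (x : R) : 0 <= x ->
  sin x <= x - x ^+ 3 / 6 + x ^+ 5 / 120.
Proof.
have c2 (y : R) : 0 <= y -> 0 <= 1 - y ^+ 2 / 2 + y ^+ 4 / 24 - cos y.
  apply: (@nonneg_of_derive _ (fun y => 1 - y ^+ 2 / 2 + y ^+ 4 / 24 - cos y)
    (fun y => sin y - (y - y ^+ 3 / 6))).
  - move=> z; apply: is_derive_eq; rewrite !scaler1 /GRing.scale/=; by field.
  - by rewrite cos0; field.
  - by move=> z z0; rewrite subr_ge0 sin_ge_cubic.
move=> x0; rewrite -subr_ge0; move: x x0.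
apply: (@nonneg_of_derive _ (fun x => x - x ^+ 3 / 6 + x ^+ 5 / 120 - sin x)
  (fun y => 1 - y ^+ 2 / 2 + y ^+ 4 / 24 - cos y)).
- move=> z; apply: is_derive_eq; rewrite !scaler1 /GRing.scale/=; by field.
- by rewrite sin0; field.
- exact: c2.
Qed.

(** The quintic majorant of sine times [1 + x^2/6] loses its cubic term, and what remains,
    [x - x^5 (14 - x^2) / 720], is at most [x]. This bounds the denominator of the distortion
    coefficient. *)
Lemma sin_mul_le (R : realType) (x : R) : 0 <= x <= 1 ->
  sin x * (1 + x ^+ 2 / 6) <= x.
Proof.
move=> /andP[x0 x1].
have h := sin_le_quintic x0.
have x2 : x ^+ 2 <= 1 by rewrite exprn_ile1.
have x2' : 0 <= x ^+ 2 by rewrite exprn_ge0.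
apply: (@le_trans _ _ ((x - x ^+ 3 / 6 + x ^+ 5 / 120) * (1 + x ^+ 2 / 6))).
  by rewrite ler_wpM2r//; nra.
have -> : (x - x ^+ 3 / 6 + x ^+ 5 / 120) * (1 + x ^+ 2 / 6) =
  x - x ^+ 5 * (14 - x ^+ 2) / 720 by field.
have : 0 <= x ^+ 5 by rewrite exprn_ge0.
move: (x ^+ 5) (x ^+ 2) x2 x2' => a b; nra.
Qed.

(** The numerator is bounded below by the cubic minorant, [t x (1 - t^2 x^2 / 6)], and the
    denominator above by [sin_mul_le]. Since [x <= 1], the loss in the numerator is absorbed by the
    factor [1 - t^2], so the whole gain [1 + x^2/6] survives. *)
Lemma sin_ratio_ge (R : realType) (t x : R) : 0 < t < 1 -> 0 < x <= 1 ->
  t * (1 - t ^+ 2) * (1 + x ^+ 2 / 6) <= sin (t * x) / sin x.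
Proof.
move=> /andP[t0 t1] /andP[x0 x1].
have sx : 0 < sin x by apply: sin2_gt0; rewrite x0 (le_lt_trans x1)// ltr1n.
rewrite ler_pdivlMr// mulrAC.
have x2 : x ^+ 2 <= 1 by rewrite exprn_ile1// ltW.
have x2' : 0 <= x ^+ 2 by rewrite exprn_ge0// ltW.
have t2 : t ^+ 2 <= 1 by rewrite exprn_ile1// ltW.
have t2' : 0 <= t ^+ 2 by rewrite exprn_ge0// ltW.
have tx : 0 <= t * x by rewrite mulr_ge0// ltW.
apply: (le_trans _ (sin_ge_cubic tx)).
have -> : t * x - (t * x) ^+ 3 / 6 = t * (1 - t ^+ 2 * x ^+ 2 / 6) * x by field.
have := @sin_mul_le R x; rewrite (ltW x0) x1 => /(_ isT) h.
have -> : t * (1 - t ^+ 2) * sin x * (1 + x ^+ 2 / 6) =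
  t * ((1 - t ^+ 2) * (sin x * (1 + x ^+ 2 / 6))) by ring.
rewrite -mulrA ler_wpM2l ?(ltW t0)//.
apply: (@le_trans _ _ ((1 - t ^+ 2) * x)); first by rewrite ler_wpM2l// subr_ge0.
rewrite ler_wpM2r ?(ltW x0)//.
move: (t ^+ 2) (x ^+ 2) x2 x2' t2 t2' => a b; nra.
Qed.

Lemma bernoulli_ineq (R : realType) (x : R) n : 0 <= x ->
  1 + n%:R * x <= (1 + x) ^+ n.
Proof.
move=> x0; elim: n => [|n ih]; first by rewrite mul0r addr0 expr0.
rewrite exprS; apply: (@le_trans _ _ ((1 + x) * (1 + n%:R * x))); last first.
  by rewrite ler_wpM2l// addr_ge0.
rewrite -natr1; have : 0 <= n%:R :> R by [].
by move: (n%:R) => a a0; nra.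
Qed.

(** The coefficient is [t^(1/n) sigma^(1-1/n)] with [sigma] taken in dimension [n - 1]. The sine
    estimate gives [sigma >= t (1 - t^2) (1 + q)] with [q = K theta^2 / (6 (n - 1))], and Bernoulli
    turns the power [(n - 1)/n] of [1 + q] into the power [1/n] of [1 + (n - 1) q]. The existential
    form also records that the coefficient is finite. *)
Lemma tauKN_ge (R : realType) (n : nat) (K theta t : R) : (2 <= n)%N ->
  0 <= K -> 0 <= theta -> K * theta ^+ 2 <= 1 -> 0 < t < 1 ->
  exists2 s : R, tauKN K n%:R theta t = s%:E &
    t * (1 - t ^+ 2) * (1 + K * theta ^+ 2 / 6) `^ n%:R^-1 <= s.
Proof.
move=> n2 K0 th0 Kth /andP[t0 t1].
have N0 : 0 < n%:R :> R by rewrite ltr0n (leq_trans _ n2).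
have N1 : 1 <= n%:R - 1 :> R by rewrite lerBrDr (_ : 1 + 1 = 2%:R)// ler_nat.
have Nn : n%:R - 1 = n.-1%:R :> R.
  by case: n n2 {N0 N1} => // n _; rewrite -natr1 addrK.
have iN1 : n%:R^-1 <= 1 :> R by rewrite invf_le1// ler1n (leq_trans _ n2).
have iN0 : 0 < n%:R^-1 :> R by rewrite invr_gt0.
have t2 : t ^+ 2 < 1 by rewrite exprn_ilt1// ltW.
have t2' : 0 < t ^+ 2 by rewrite exprn_gt0.
have tau_of s : sigmaKN K (n%:R - 1) theta t = s%:E ->
   t * (1 - t ^+ 2) * (1 + K * theta ^+ 2 / (6 * (n%:R - 1))) <= s ->
   exists2 s : R, tauKN K n%:R theta t = s%:E &
    t * (1 - t ^+ 2) * (1 + K * theta ^+ 2 / 6) `^ n%:R^-1 <= s.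
  move=> sE hs; exists (t `^ n%:R^-1 * s `^ (1 - n%:R^-1)).
    by rewrite /tauKN sE.
  set q := K * theta ^+ 2 / (6 * (n%:R - 1)) in hs.
  have q0 : 0 <= q.
    rewrite /q divr_ge0// ?mulr_ge0// ?exprn_ge0//; lra.
  apply: (@le_trans _ _ (t `^ n%:R^-1 *
      (t * (1 - t ^+ 2) * (1 + q)) `^ (1 - n%:R^-1))); last first.
    rewrite ler_wpM2l ?powR_ge0//; apply: ge0_ler_powR => //.
    - by rewrite subr_ge0.
    - by rewrite nnegrE !mulr_ge0//; lra.
    - by rewrite nnegrE (le_trans _ hs)// !mulr_ge0//; lra.
  have -> : t `^ n%:R^-1 * (t * (1 - t ^+ 2) * (1 + q)) `^ (1 - n%:R^-1) =
      t * ((1 - t ^+ 2) `^ (1 - n%:R^-1) * (1 + q) `^ (1 - n%:R^-1)).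
    rewrite -mulrA powRM ?mulr_ge0//; try lra.
    rewrite powRM; try lra.
    rewrite mulrA -powRD; last by apply/implyP => _; rewrite gt_eqF.
    by rewrite [n%:R^-1 + _]addrC subrK powRr1 ?(ltW t0).
  (* The base is at most 1, so an exponent below 1 can only increase it. *)
  have h1 : 1 - t ^+ 2 <= (1 - t ^+ 2) `^ (1 - n%:R^-1).
    apply: ger1_powR; first by lra.
    by lra.
  (* As [1 - 1/n = (n - 1)/n], the right side is the [n]-th root of [(1 + q)^(n-1)], to which
     Bernoulli applies. *)
  have h2 : (1 + K * theta ^+ 2 / 6) `^ n%:R^-1 <= (1 + q) `^ (1 - n%:R^-1).
    have -> : 1 - n%:R^-1 = n.-1%:R * n%:R^-1 :> R.
      by rewrite -Nn mulrBl mul1r divff// gt_eqF.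
    rewrite powRrM powR_mulrn; last by lra.
    apply: ge0_ler_powR; first exact: ltW.
    - by rewrite nnegrE addr_ge0// divr_ge0// mulr_ge0// exprn_ge0.
    - by rewrite nnegrE exprn_ge0// addr_ge0.
    - apply: le_trans (bernoulli_ineq _ q0); rewrite -Nn /q lerD2l.
      by rewrite le_eqVlt; apply/orP; left; apply/eqP; field; lra.
  rewrite -mulrA ler_wpM2l ?(ltW t0)//.
  by apply: ler_pM => //; rewrite ?powR_ge0//; lra.
(* Together with [K theta^2 <= 1] this excludes the infinite branch of [sigmaKN]. *)
have pi1 : 1 < (n%:R - 1) * pi ^+ 2 :> R.
  have := @pi_ge2 R; move: (pi) => p p2; rewrite expr2; nra.
have sg0 : sigmaKN K (n%:R - 1) theta t =
   if 0 < K * theta ^+ 2 then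
    (sin (t * theta * Num.sqrt (K / (n%:R - 1))) / sin (theta * Num.sqrt (K / (n%:R - 1))))%:E
   else t%:E.
  rewrite /sigmaKN leNgt (le_lt_trans Kth pi1)/=.
  case: ifPn => //; rewrite -leNgt => le0; rewrite ifT// eq_le le0/=.
  by rewrite mulr_ge0// exprn_ge0.
move: sg0; case: ifPn => [a0 sg|a0 sg]; last first.
  apply: tau_of sg _.
  have -> : K * theta ^+ 2 = 0.
    by apply/eqP; rewrite eq_le leNgt a0/= mulr_ge0// exprn_ge0.
  by rewrite mul0r addr0 mulr1; nra.
apply: tau_of sg _.
set x := theta * Num.sqrt (K / (n%:R - 1)).
have x2 : x ^+ 2 = K * theta ^+ 2 / (n%:R - 1).
  rewrite /x exprMn sqr_sqrtr; first by field; lra.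
  by rewrite divr_ge0//; lra.
have x0 : 0 < x.
  rewrite lt_neqAle mulr_ge0// ?sqrtr_ge0// andbT eq_sym -sqrf_eq0 x2.
  by rewrite gt_eqF// divr_gt0//; lra.
have -> : t * theta * Num.sqrt (K / (n%:R - 1)) = t * x by rewrite /x mulrA.
have -> : K * theta ^+ 2 / (6 * (n%:R - 1)) = x ^+ 2 / 6.
  by rewrite x2; field; lra.
apply: sin_ratio_ge; first by rewrite t0.
rewrite x0/= -(ler_pXn2r (_ : 0 < 2)%N) ?nnegrE ?(ltW x0)// expr1n x2.
by rewrite ler_pdivrMr; lra.
Qed.

(** * Lower bound for the volume of small balls in the product of a 2-sphere and a Euclidean
    space *)

Lemma omega_gt0 (R : realType) k : 0 < @omega R k.
Proof.
suff : 0 < @omega R k /\ 0 < @omega R k.+1 by case.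
elim: k => [|k [h1 h2]]; first by split => //=.
by split => //=; rewrite mulr_gt0// divr_gt0// mulr_gt0// pi_gt0.
Qed.

Lemma continuous_sqrt_subr (R : realType) (e : R) :
  continuous (fun s : R => Num.sqrt (e ^+ 2 - s ^+ 2)).
Proof.
move=> s; apply: (@continuous_comp R R R (fun s => e ^+ 2 - s ^+ 2) (@Num.sqrt R)).
  by apply: cvgB; [exact: cvg_cst|exact: exprn_continuous].
exact: sqrt_continuous.
Qed.

Lemma is_derive_exprS (R : realType) (k : nat) (y : R) :
  is_derive y 1 (fun y : R => y ^+ k.+1) (k.+1%:R * y ^+ k).
Proof.
apply: DeriveDef; first exact: exprn_derivable.
rewrite exp_derive.
by rewrite /GRing.scale/= mulr1.
Qed.

(** With [b = 1/(6 g^2)] the factor [s (1 - b s^2)] is the cubic minorant of [g sin (s/g)], so this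
    evaluates a minorant of the integral in [volSE], up to the constant [2 pi omega m]. *)
Lemma volSE_integral (R : realType) (m : nat) (b e : R) : 0 < e ->
  (\int[@lebesgue_measure R]_(s in `[0%R, e]%classic)
     (s * (1 - b * s ^+ 2) * Num.sqrt (e ^+ 2 - s ^+ 2) ^+ m)%R%:E =
   ((1 - b * e ^+ 2) * e ^+ m.+2 / m.+2%:R + b * e ^+ m.+4 / m.+4%:R)%R%:E)%E.
Proof.
move=> e0.
pose w (s : R) : R := Num.sqrt (e ^+ 2 - s ^+ 2).
(* Antiderivative in the variable [w], where [s ds = - w dw]. *)
pose F (s : R) := - ((1 - b * e ^+ 2) * w s ^+ m.+2 / m.+2%:R + b * w s ^+ m.+4 / m.+4%:R).
have cw : continuous w := @continuous_sqrt_subr _ e.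
have cF : continuous F.
  move=> s; apply: cvgN; apply: cvgD; apply: cvgM; try exact: cvg_cst;
  apply: cvgM; try exact: cvg_cst.
  - apply: (@continuous_comp R R R w (fun x => x ^+ _)); [exact: cw|exact: exprn_continuous].
  - apply: (@continuous_comp R R R w (fun x => x ^+ _)); [exact: cw|exact: exprn_continuous].
pose G (y : R) : R := - ((1 - b * e ^+ 2) * y ^+ m.+2 / m.+2%:R + b * y ^+ m.+4 / m.+4%:R).
have derG (y : R) : is_derive y 1 G (- ((1 - b * e ^+ 2) * y ^+ m.+1 + b * y ^+ m.+3)).
  have h (k : nat) (c : R) : is_derive y 1 (fun y : R => c * y ^+ k.+1 / k.+1%:R) (c * y ^+ k).
    have -> : (fun y : R => c * y ^+ k.+1 / k.+1%:R) = (c / k.+1%:R) \*: (fun y : R => y ^+ k.+1).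
      by apply/funext => z /=; rewrite /GRing.scale/= mulrAC.
    have := @is_deriveZ R R R (fun y : R => y ^+ k.+1) (c / k.+1%:R) y 1 _ (is_derive_exprS k y).
    have -> : (c / k.+1%:R) *: (k.+1%:R * y ^+ k) = c * y ^+ k.
      rewrite /GRing.scale/=; have : 0 <= k%:R :> R by [].
      by move=> k0; field; lra.
    by [].
  exact: is_deriveN (is_deriveD (h _ _) (h _ _)).
have dF s : s \in `]0, e[ -> is_derive s 1 F (s * (1 - b * s ^+ 2) * w s ^+ m).
  rewrite in_itv/= => /andP[s0 se].
  (* The square root is differentiable only away from 0, hence the open interval; at the endpoint
     [e] continuity of [F] is enough for the fundamental theorem of calculus. *)
  have p0 : 0 < e ^+ 2 - s ^+ 2.
    by rewrite subr_gt0 ltr_pXn2r// ?nnegrE ltW.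
  have dw : is_derive s 1 w (- s / w s).
    have := @is_derive1_comp R Num.sqrt (fun s => e ^+ 2 - s ^+ 2) s
      _ _ (is_derive1_sqrt p0) _.
    move=> /(_ (- (2 * s))) h; apply: is_derive_eq.
      apply: h; apply: is_derive_eq.
      by rewrite /GRing.scale/=; ring.
    rewrite /w; field; by rewrite gt_eqF// sqrtr_gt0.
  have w0 : w s != 0 by rewrite gt_eqF// sqrtr_gt0.
  have w2 : w s ^+ 2 = e ^+ 2 - s ^+ 2 by rewrite sqr_sqrtr// ltW.
  (* Since [s^2 = e^2 - w^2], the factor [1 - b s^2] equals [(1 - b e^2) + b w^2], a polynomial in
     [w]. *)
  have -> : s * (1 - b * s ^+ 2) * w s ^+ m =
      - s / w s * - ((1 - b * e ^+ 2) * w s ^+ m.+1 + b * w s ^+ m.+3).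
    have -> : e ^+ 2 = w s ^+ 2 + s ^+ 2 by rewrite w2 subrK.
    by rewrite !exprS; field.
  have dG := @is_derive1_comp R G w s _ _ (derG (w s)) dw.
  by rewrite mulrC; exact: dG.
rewrite (_ : (_ + _)%:E = (F e)%:E - (F 0)%:E)%E; last first.
  rewrite -EFinB /F /w subrr sqrtr0 expr0n/= !expr0n/= subr0 sqrtr_sqr gtr0_norm//.
  by congr EFin; ring.
apply: continuous_FTC2 => //.
- apply: continuous_subspaceT => s.
  apply: cvgM; first apply: cvgM => //.
  + apply: cvgB; first exact: cvg_cst.
    apply: cvgM; first exact: cvg_cst.
    exact: exprn_continuous.
  + apply: (@continuous_comp R R R w (fun x => x ^+ _)); [exact: cw|exact: exprn_continuous].
- split.
  + by move=> s /dF h; exact: (@ex_derive _ _ _ _ _ _ _ h).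
  + by apply: cvg_at_right_filter; exact: cF.
  + by apply: cvg_at_left_filter; exact: cF.
- move=> s /dF h; rewrite derive1E; exact: derive_val.
Qed.

(** The sine is replaced by its cubic minorant and the integral becomes explicit. With [n = m + 2]
    and [omega n = 2 pi omega m / n], it equals [omega n e^n (1 - b e^2 + b e^2 n/(n + 2))], whose
    correction is [- 2 b e^2 / (n + 2)]. *)
Lemma volSE_ge (R : realType) (n : nat) (g e : R) : (2 <= n)%N -> 0 < g ->
  0 < e -> e <= g ->
  ((omega n * e ^+ n * (1 - e ^+ 2 / (3 * g ^+ 2 * (n%:R + 2))))%:E <= volSE n g e)%E.
Proof.
move=> n2 g0 e0 eg.
have p0 := @pi_gt0 R. have p2 := @pi_ge2 R.
have om0 k : 0 <= @omega R k by rewrite ltW// omega_gt0.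
case: n n2 => [//|[//|m]] _.
pose b := (6 * g ^+ 2)^-1.
have b0 : 0 < b by rewrite invr_gt0 mulr_gt0// exprn_gt0.
(* From [e <= g] the minimum of [e] and [pi g] is [e]; the same inequality later keeps [1 - b s^2]
   nonnegative on the interval. *)
rewrite /volSE (_ : [set s | _] = `[0, e]%classic); last first.
  apply/seteqP; split => s /=; rewrite in_itv/= le_min.
    by move=> /andP[-> /andP[-> _]].
  move=> /andP[-> se]; rewrite se/= (le_trans se)// (le_trans eg)//.
  by rewrite ler_peMl ?ltW//; lra.
rewrite !subSS subn0.
have c0 : 0 <= 2 * pi * omega m :> R by rewrite mulr_ge0// mulr_ge0//; lra.
have key (s : R) : 0 <= s -> s * (1 - b * s ^+ 2) <= g * sin (s / g).
  move=> s0; have sg0 : 0 <= s / g by rewrite divr_ge0// ltW.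
  have := sin_ge_cubic sg0; rewrite -(ler_pM2l g0); apply: le_trans.
  rewrite le_eqVlt; apply/orP; left; apply/eqP; rewrite /b.
  by field; lra.
have h0 (s : R) : `[0, e]%classic s ->
    0 <= s * (1 - b * s ^+ 2) * Num.sqrt (e ^+ 2 - s ^+ 2) ^+ m.
  rewrite /= in_itv/= => /andP[s0 se].
  rewrite mulr_ge0 ?exprn_ge0 ?sqrtr_ge0// mulr_ge0// subr_ge0 /b.
  rewrite mulrC ler_pdivrMr; last by rewrite mulr_gt0// exprn_gt0.
  rewrite mul1r.
  have : s ^+ 2 <= g ^+ 2 by rewrite ler_pXn2r ?nnegrE// ?(le_trans se)// ltW.
  have : 0 <= g ^+ 2 by rewrite exprn_ge0// ltW.
  lra.
have mh : measurable_fun `[0, e]%classic (fun s : R =>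
    s * (1 - b * s ^+ 2) * Num.sqrt (e ^+ 2 - s ^+ 2) ^+ m).
  apply: measurable_funTS; apply: continuous_measurable_fun => s.
  apply: cvgM; first apply: cvgM => //.
  - apply: cvgB; first exact: cvg_cst.
    apply: cvgM; first exact: cvg_cst.
    exact: exprn_continuous.
  - apply: (@continuous_comp R R R (fun s => Num.sqrt (e ^+ 2 - s ^+ 2))
      (fun x => x ^+ _)); last exact: exprn_continuous.
    exact: continuous_sqrt_subr.
apply: (@le_trans _ _ (\int[@lebesgue_measure R]_(s in `[0%R, e]%classic)
   ((2 * pi * omega m)%R%:E * (s * (1 - b * s ^+ 2) * Num.sqrt (e ^+ 2 - s ^+ 2) ^+ m)%R%:E))%E).
  rewrite ge0_integralZl_EFin//; last exact/measurable_EFinP.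
  rewrite volSE_integral// -EFinM lee_fin le_eqVlt; apply/orP; left; apply/eqP.
  rewrite /= /b !exprS -!natr1; have : 0 <= m%:R :> R by [].
  move: (m%:R) => r r0; field; lra.
apply: ge0_le_integral => //=.
- by move=> s se; rewrite -EFinM lee_fin mulr_ge0// h0.
- by apply/measurable_EFinP; apply: measurable_funM.
- apply/measurable_EFinP; apply: measurable_funTS; apply: measurable_funM.
    apply: measurable_funM => //; apply: measurable_funM => //.
    apply: measurableT_comp; last exact: mulrr_measurable.
    by apply: continuous_measurable_fun; exact: continuous_sin.
  apply: (measurableT_comp (measurable_powR _)) => //.
  apply: continuous_measurable_fun => s.
  by apply: cvgB; [exact: cvg_cst|exact: exprn_continuous].
move=> s; rewrite in_itv/= => /andP[s0 se].
rewrite -EFinM lee_fin.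
have -> : (e ^+ 2 - s ^+ 2) `^ (m%:R / 2) = Num.sqrt (e ^+ 2 - s ^+ 2) ^+ m.
  have es : 0 <= e ^+ 2 - s ^+ 2 by rewrite subr_ge0 ler_pXn2r ?nnegrE// ltW.
  by rewrite mulrC powRrM powR12_sqrt// powR_mulrn// sqrtr_ge0.
rewrite mulrA ler_wpM2r ?exprn_ge0 ?sqrtr_ge0//.
have -> : 2 * pi * g * sin (s / g) * omega m = 2 * pi * omega m * (g * sin (s / g)) by ring.
rewrite ler_wpM2l//.
exact: key.
Qed.

(** * Balls and distances in a separable metric measure space *)

Lemma measurable_fun_lt_sets (dX : measure_display) (X : measurableType dX)
    (R : realType) (f : X -> R) :
  (forall r : R, measurable [set x | f x < r]) -> measurable_fun setT f.
Proof.
move=> fr; apply: (measurability _ (RGenInftyO.measurableE R)) => A [_ [r ->] <-].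
rewrite setTI; suff -> : f @^-1` `]-oo, r[ = [set x | f x < r] by [].
by apply/seteqP; split => x /=; rewrite in_itv.
Qed.

Lemma countable_dense_seq (R : realType) (X : Type) (d : X -> X -> R) :
  X -> d_separable d ->
  exists u : nat -> X, forall x (e : R), 0 < e -> exists i, d x (u i) < e.
Proof.
move=> x0 [D [/pfcard_geP [D0|/surjfunPex[u uD]] dD]].
  by have [y] := dD x0 1 ltr01; rewrite D0.
exists u => x e /(dD x)[y]; rewrite uD => -[i _ <-]; by exists i.
Qed.

Section metric_measurability.
Context (dX : measure_display) (X : measurableType dX) (R : realType).
Context (d : X -> X -> R).
Context (dm : is_metric d).
Context (mX : (@measurable _ X : set (set X)) = <<s [set A | d_open d A] >>).

Lemma measurable_d_open (A : set X) : d_open d A -> measurable A.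
Proof. by move=> oA; rewrite mX; exact: sub_sigma_algebra. Qed.

Lemma measurable_oball x r : measurable (oball d x r).
Proof.
have [_ _ _ dt] := dm.
apply: measurable_d_open => y /= xyr; exists (r - d x y).
  by rewrite subr_gt0.
by move=> z /=; rewrite /oball/= ltrBrDl => h; exact: le_lt_trans (dt x y z) h.
Qed.

Lemma measurable_dist_l x : measurable_fun setT (d x).
Proof. by apply: measurable_fun_lt_sets => r; exact: measurable_oball. Qed.

Lemma measurable_cball x r : measurable (cball d x r).
Proof.
rewrite -[X in measurable X]setTI.
rewrite (_ : cball d x r = (d x) @^-1` `]-oo, r]); last first.
  by apply/seteqP; split => y /=; rewrite in_itv.
exact: measurable_dist_l.
Qed.

(** Separability brings the distance into the product sigma-algebra: [d a b < r] holds exactly when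
    some point [u i] of a dense sequence satisfies [d (u i) a + d (u i) b < r], and each such
    condition involves only functions of one variable. *)
Lemma measurable_dist : d_separable d ->
  measurable_fun setT (fun z : X * X => d z.1 z.2).
Proof.
move=> sd; apply: measurable_fun_lt_sets => r.
have [d0 d00 ds dt] := dm.
have [z0|noz] := pselect (exists z : X, True); last first.
  rewrite (_ : [set _ | _] = set0)//; apply/seteqP; split => // -[a b] _.
  by apply: noz; exists a.
have [u du] := countable_dense_seq (projT1 (cid z0)) sd.
rewrite (_ : [set _ | _] =
  \bigcup_i [set z : X * X | d (u i) z.1 + d (u i) z.2 < r]); last first.
  apply/seteqP; split => [[a b]/= abr|[a b] [i _ /=]].
    have [|i ai] := du a ((r - d a b) / 2); first by rewrite divr_gt0// subr_gt0.
    exists i => //=; rewrite (ds _ a).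
    have := dt (u i) a b; rewrite (ds (u i) a); lra.
  by apply: le_lt_trans; rewrite [in leRHS](ds _ a).
apply: bigcup_measurable => i _.
have mf : measurable_fun setT (fun z : X * X => d (u i) z.1 + d (u i) z.2).
  apply: measurable_funD; apply: measurableT_comp => //; exact: measurable_dist_l.
rewrite -[X in measurable X]setTI.
rewrite (_ : [set _ | _] =
  (fun z : X * X => d (u i) z.1 + d (u i) z.2) @^-1` `]-oo, r[); last first.
  by apply/seteqP; split => y /=; rewrite in_itv.
exact: mf.
Qed.

End metric_measurability.

(** * Gluing couplings and the support of Wasserstein interpolants *)

Lemma ge0_integral_image (d1 d2 : measure_display) (T1 : measurableType d1)
    (T2 : measurableType d2) (R : realType) (P : probability T1 R)
    (Q : probability T2 R) (f : T1 -> T2) (g : T2 -> \bar R) :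
  measurable_fun setT f -> (forall E, measurable E -> P (f @^-1` E) = Q E) ->
  measurable_fun setT g -> (forall y, 0 <= g y)%E ->
  (\int[P]_x g (f x) = \int[Q]_y g y)%E.
Proof.
move=> mf PQ mg g0.
pose F : {mfun T1 >-> T2} := HB.pack f (isMeasurableFun.Build _ _ _ _ f mf).
transitivity (\int[distribution P F]_y g y)%E.
  by rewrite ge0_integral_distribution.
by apply: eq_measure_integral => E mE _; exact: (PQ E mE).
Qed.

Section gluing.
Context (dX : measure_display) (X : measurableType dX) (R : realType).
Context (d : X -> X -> R).
Context (dm : is_metric d).
Context (sd : d_separable d).
Context (mX : (@measurable _ X : set (set X)) = <<s [set A | d_open d A] >>).

(** The balls of radius [e/2] about a dense sequence cover, and removing from each the earlier ones
    makes them disjoint. If [X] is empty, empty cells do. *)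
Lemma small_partition (e : R) : 0 < e ->
  exists P : nat -> set X, [/\ forall i, measurable (P i), trivIset setT P,
    \bigcup_i P i = setT & forall i y y', P i y -> P i y' -> d y y' <= e].
Proof.
move=> e0; have [d0 d00 ds dt] := dm.
have [z0|noz] := pselect (exists z : X, True); last first.
  exists (fun=> set0); split => //.
  - by move=> i j _ _ [x []].
  - by apply/seteqP; split => // x _; case: noz; exists x.
have [u du] := countable_dense_seq (projT1 (cid z0)) sd.
have e2 : 0 < e / 2 by lra.
pose F i := oball d (u i) (e / 2).
exists (seqDU F); split.
- move=> i; apply: measurableD; first exact: measurable_oball.
  by apply: bigsetU_measurable => j _; exact: measurable_oball.
- exact: trivIset_seqDU.
- rewrite -seqDU_bigcup_eq; apply/seteqP; split => // x _.
  by have [i xi] := du x _ e2; exists i => //; rewrite /F /oball/= ds.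
- move=> i y y' [+ _] [+ _]; rewrite /F /oball/= => h h'.
  by have := dt y (u i) y'; rewrite (ds y (u i)); lra.
Qed.

(** An approximate gluing lemma: the two copies of the middle point are only required to lie in the
    same cell of a fine partition, hence to be within [e] of each other, while both couplings are
    recovered exactly as marginals. *)
Lemma glue_couplings (q0 q1 : probability (X * X)%type R) (nt : probability X R) (e : R) :
  0 < e ->
  (forall A, measurable A -> q0 (setT `*` A) = nt A) ->
  (forall A, measurable A -> q1 (A `*` setT) = nt A) ->
  exists Pi : probability ((X * X) * (X * X))%type R,
    [/\ forall E, measurable E -> Pi (E `*` setT) = q0 E,
        forall E, measurable E -> Pi (setT `*` E) = q1 E &
        Pi [set w | e < d w.1.2 w.2.1] = 0%E].
Proof.
move=> e0 q0m q1m.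
have [P [mP tP UP Pe]] := small_partition e0.
(* For a quadruple [((a, b), (b', c))] this says that both middle points [b] and [b'] lie in the
   cell [P i]. *)
pose C i : set ((X * X) * (X * X)) := (setT `*` P i) `*` (P i `*` setT).
have mC i : measurable (C i).
  by apply: measurableX; apply: measurableX.
have c0 i : 0 <= (fine (nt (P i)))^-1 by rewrite invr_ge0 fine_ge0.
(* The glued measure makes both couplings conditionally independent given the
   cell of the middle point; null cells drop out because [0^-1 = 0]. *)
pose M i : {measure set ((X * X) * (X * X)) -> \bar R} :=
  mscale (NngNum (c0 i)) (mrestr (q0 \x q1)%E (mC i)).
pose Pi0 : set ((X * X) * (X * X)) -> \bar R := mseries M 0.
have ntfin i : nt (P i) \is a fin_num by exact: fin_num_measure.
have pE A B : measurable A -> measurable B ->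
    (q0 \x q1)%E (A `*` B) = (q0 A * q1 B)%E.
  by move=> mA mB; exact: product_measure1E.
have ME1 i E : measurable E -> M i (E `*` setT) = q0 (E `&` (setT `*` P i)).
  move=> mE; rewrite /M /= /mscale/= /mrestr.
  have -> : (E `*` setT) `&` C i = (E `&` (setT `*` P i)) `*` (P i `*` setT).
    by apply/seteqP; split => [[[a b] [c f]]|[[a b] [c f]]] /= => -[]; rewrite /C/=; tauto.
  have mEP : measurable (E `&` (setT `*` P i)) by apply: measurableI => //; exact: measurableX.
  rewrite [X in (_ * X)%E]pE//; last exact: measurableX.
  rewrite q1m//.
  (* On a null cell the left side vanishes by the convention on inverses, and so does the right
     side, being at most [nt (P i)]. *)
  have [nt0|nt0] := eqVneq (nt (P i)) 0%E.
    rewrite nt0 !mule0; apply/esym/eqP; rewrite eq_le measure_ge0 andbT.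
    rewrite -nt0 -q0m// le_measure// ?inE//; exact: measurableX.
  rewrite muleC -muleA -[X in (_ * (X * _))%E]fineK// -EFinM divff ?mule1//.
  by rewrite fine_eq0.
have ME2 i E : measurable E -> M i (setT `*` E) = q1 (E `&` (P i `*` setT)).
  move=> mE; rewrite /M /= /mscale/= /mrestr.
  have -> : (setT `*` E) `&` C i = (setT `*` P i) `*` (E `&` (P i `*` setT)).
    by apply/seteqP; split => [[[a b] [c f]]|[[a b] [c f]]] /= => -[]; rewrite /C/=; tauto.
  have mEP : measurable (E `&` (P i `*` setT)) by apply: measurableI => //; exact: measurableX.
  rewrite [X in (_ * X)%E]pE//; last exact: measurableX.
  rewrite q0m//.
  have [nt0|nt0] := eqVneq (nt (P i)) 0%E.
    rewrite nt0 mul0e mule0; apply/esym/eqP; rewrite eq_le measure_ge0 andbT.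
    rewrite -nt0 -q1m// le_measure// ?inE//; exact: measurableX.
  rewrite muleA -[X in (_ * X * _)%E]fineK// -EFinM mulVf ?mul1e//.
  by rewrite fine_eq0.
have sumq (q : probability (X * X)%type R) (D : nat -> set (X * X)) E :
    measurable E -> (forall i, measurable (D i)) -> trivIset setT D ->
    \bigcup_i D i = setT -> (\sum_(0 <= i <oo) q (E `&` D i) = q E)%E.
  move=> mE mD tD UD; rewrite -[in RHS](setIT E) -UD setI_bigcupr.
  rewrite measure_bigcup//=.
  - by apply: eq_eseriesl => i; rewrite in_setT.
  - by move=> i _; exact: measurableI.
  - exact: trivIset_setIl.
have Pi1 E : measurable E -> Pi0 (E `*` setT) = q0 E.
  move=> mE; rewrite -[RHS](sumq _ (fun i => setT `*` P i))//.
  - by apply: eq_eseriesr => i _; exact: ME1.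
  - by move=> i; exact: measurableX.
  - move=> i j _ _ [[a b] [[_ Pi] [_ Pj]]]; apply: (tP i j) => //; by exists b.
  - apply/seteqP; split => // -[a b] _.
    by have [i _ Pib] : (\bigcup_i P i) b by [rewrite UP]; exists i.
have Pi2 E : measurable E -> Pi0 (setT `*` E) = q1 E.
  move=> mE; rewrite -[RHS](sumq _ (fun i => P i `*` setT))//.
  - by apply: eq_eseriesr => i _; exact: ME2.
  - by move=> i; exact: measurableX.
  - move=> i j _ _ [[a b] [[Pi _] [Pj _]]]; apply: (tP i j) => //; by exists a.
  - apply/seteqP; split => // -[a b] _.
    by have [i _ Pib] : (\bigcup_i P i) a by [rewrite UP]; exists i.
have PiT : Pi0 setT = 1%E.
  by rewrite -setXTT Pi1// probability_setT.
pose Pi : probability ((X * X) * (X * X))%type R :=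
  HB.pack Pi0 (Measure.on Pi0) (Measure_isProbability.Build _ _ _ Pi0 PiT).
exists Pi; split => //.
pose bad := [set w : (X * X) * (X * X) | e < d w.1.2 w.2.1].
have badC i : bad `&` C i = set0.
  apply/seteqP; split => // -[[a b] [c f]] [/= + [[_ /= Pb] [/= Pc _]]].
  by rewrite /bad/= ltNge (Pe _ _ _ Pb Pc).
apply: (@eseries0 _ _ 0%N predT) => i _ _.
have -> : M i bad = ((fine (nt (P i)))^-1%:E * (q0 \x q1) (bad `&` C i))%E by [].
by rewrite badC measure0 mule0.
Qed.

End gluing.

(** Here [a], [b], [c] stand for the distances [x] to [y], [y] to [z], [x] to [z]. The bracket on
    the right splits into [e1^2 / (t (1 - t))], the defect in convexity of the square, and
    [(a + b)^2 - c^2 >= e2^2], the defect in the triangle inequality. It therefore controls how far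
    [y] is from being a [t]-intermediate point. *)
Lemma midpoint_ineq (R : realType) (t a b c : R) : 0 < t < 1 -> 0 <= a -> 0 <= b ->
  0 <= c -> c <= a + b ->
  (a - t * c) ^+ 2 <= 2 * (a ^+ 2 / t + b ^+ 2 / (1 - t) - c ^+ 2).
Proof.
move=> /andP[t0 t1] a0 b0 c0 cab.
have t1' : 0 < 1 - t by lra.
pose e1 := (1 - t) * a - t * b. pose e2 := a + b - c.
have -> : a - t * c = e1 + t * e2 by rewrite /e1 /e2; ring.
have -> : a ^+ 2 / t + b ^+ 2 / (1 - t) - c ^+ 2 =
   e1 ^+ 2 / (t * (1 - t)) + ((a + b) ^+ 2 - c ^+ 2).
  by rewrite /e1; field; lra.
have h1 : e1 ^+ 2 <= e1 ^+ 2 / (t * (1 - t)).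
  rewrite ler_peMr ?sqr_ge0// invf_ge1 ?mulr_gt0//; nra.
have h2 : e2 ^+ 2 <= (a + b) ^+ 2 - c ^+ 2 by rewrite /e2; nra.
have h3 : (t * e2) ^+ 2 <= e2 ^+ 2.
  rewrite exprMn ler_piMl ?sqr_ge0// exprn_ile1//; lra.
have h4 : (e1 + t * e2) ^+ 2 <= 2 * (e1 ^+ 2 + (t * e2) ^+ 2).
  have := sqr_ge0 (e1 - t * e2); move: (t * e2) => z; nra.
apply: (le_trans h4); rewrite ler_pM2l//; lra.
Qed.

(** The integrand inequality for a glued quadruple, [e] being the gap between the two middle points
    and [o] telling whether the first of them lies in the forbidden set. The gap is absorbed through
    [2 e b <= e b^2 + e]; if [o] holds then [a - t c >= eta], which produces the extra
    [eta^2 / 2]. *)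
Lemma glued_cost_ineq (R : realType) (t e L eta a b c : R) (o : bool) :
  0 < t < 1 -> 0 < e -> 0 < eta -> 0 <= a -> 0 <= b -> 0 <= c ->
  c <= a + (b + e) -> c <= L -> (o -> t * L + eta <= a) ->
  c ^+ 2 + eta ^+ 2 / 2 * o%:R <=
  t^-1 * a ^+ 2 + ((1 + e) / (1 - t) * b ^+ 2 + (e ^+ 2 + e) / (1 - t)).
Proof.
move=> t01 e0 eta0 a0 b0 c0 cab cL oa; have [t0 t1] := andP t01.
have t1' : 0 < 1 - t by lra.
have be : 0 <= b + e by lra.
have hm := midpoint_ineq t01 a0 be c0 cab.
have hb : (b + e) ^+ 2 <= (1 + e) * b ^+ 2 + (e ^+ 2 + e).
  have -> : (1 + e) * b ^+ 2 + (e ^+ 2 + e) = (b + e) ^+ 2 + e * (b - 1) ^+ 2 by ring.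
  by rewrite lerDl mulr_ge0 ?sqr_ge0// ltW.
have hb' : (b + e) ^+ 2 / (1 - t) <= ((1 + e) * b ^+ 2 + (e ^+ 2 + e)) / (1 - t).
  by rewrite ler_pM2r ?invr_gt0.
have -> : t^-1 * a ^+ 2 + ((1 + e) / (1 - t) * b ^+ 2 + (e ^+ 2 + e) / (1 - t)) =
   a ^+ 2 / t + ((1 + e) * b ^+ 2 + (e ^+ 2 + e)) / (1 - t) by field; lra.
case: o oa => [/(_ isT) oa|_]; last by have := sqr_ge0 (a - t * c); rewrite mulr0; lra.
have ha : eta <= a - t * c.
  have : t * c <= t * L by rewrite ler_pM2l.
  lra.
have : eta ^+ 2 <= (a - t * c) ^+ 2.
  by rewrite ler_pXn2r ?nnegrE ?(ltW eta0)// (le_trans (ltW eta0)).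
by rewrite mulr1; lra.
Qed.

(** * Localisation of an interpolating measure near the intermediate points *)

Section interpolation_support.
Context (dX : measure_display) (X : measurableType dX) (R : realType).
Context (d : X -> X -> R).
Context (dm : is_metric d).
Context (sd : d_separable d).
Context (mX : (@measurable _ X : set (set X)) = <<s [set A | d_open d A] >>).

Lemma measurable_dist_sqr :
  measurable_fun setT (fun z : X * X => ((d z.1 z.2) ^+ 2)%:E).
Proof.
apply/measurable_EFinP; apply: measurable_funX; exact: measurable_dist.
Qed.

Lemma W2sq_near_optimal (nu0 nu1 : probability X R) (w e : R) : 0 < e ->
  W2sq d nu0 nu1 = w%:E ->
  exists2 q : probability (X * X)%type R, is_coupling nu0 nu1 q &
    (\int[q]_z ((d z.1 z.2) ^+ 2)%:E <= (w + e)%:E)%E.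
Proof.
move=> e0 wE.
have fin : W2sq d nu0 nu1 \is a fin_num by rewrite wE.
have [_ [q qc <-] qlt] := lb_ereal_inf_adherent e0 fin.
exists q => //; apply: ltW; move: qlt.
by rewrite -/(W2sq d nu0 nu1) wE.
Qed.

(** The inequality [glued_cost_ineq] is integrated against the glued measure. The outer points of
    the quadruple form a coupling of [nu0] and [nu1], so the left side is at least [w] plus the
    contribution of [O]; the right side is bounded by the near-optimal costs of the two halves. *)
Lemma interpolation_bound (nu0 nt nu1 : probability X R) (S0 S1 O : set X)
    (t L eta w e : R) :
  0 < t < 1 -> 0 < eta -> 0 < e ->
  measurable S0 -> measurable S1 -> measurable O ->
  nu0 (~` S0) = 0%E -> nu1 (~` S1) = 0%E ->
  (forall x y, S0 x -> S1 y -> d x y <= L) ->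
  (forall x y, S0 x -> O y -> t * L + eta <= d x y) ->
  W2sq d nu0 nu1 = w%:E ->
  W2sq d nu0 nt = (t ^+ 2 * w)%:E ->
  W2sq d nt nu1 = ((1 - t) ^+ 2 * w)%:E ->
  w + eta ^+ 2 / 2 * fine (nt O) <=
    t^-1 * (t ^+ 2 * w + e) +
    ((1 + e) / (1 - t) * ((1 - t) ^+ 2 * w + e) + (e ^+ 2 + e) / (1 - t)).
Proof.
move=> t01 eta0 e0 mS0 mS1 mO nuS0 nuS1 SL SO wE w0E w1E.
have [d0 d00 ds dt] := dm.
have [t0 t1] := andP t01.
have t1' : 0 < 1 - t by lra.
pose d2 : X * X -> \bar R := fun z => ((d z.1 z.2) ^+ 2)%:E.
have [q0 c0 q0le] := W2sq_near_optimal e0 w0E.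
have [q1 c1 q1le] := W2sq_near_optimal e0 w1E.
have [Pi [Pi1 Pi2 PiB]] := @glue_couplings _ _ _ _ dm sd mX q0 q1 nt _ e0
  (fun A mA => (c0 A mA).2) (fun A mA => (c1 A mA).1).
pose W := ((X * X) * (X * X))%type.
have mends : measurable_fun setT (fun z : W => (z.1.1, z.2.2)).
  by apply: measurable_fun_pair; apply: measurableT_comp.
pose ends : {mfun W >-> (X * X)%type} :=
  HB.pack (fun z : W => (z.1.1, z.2.2)) (isMeasurableFun.Build _ _ _ _ _ mends).
pose q : probability (X * X)%type R := distribution Pi ends.
have qc : is_coupling nu0 nu1 q.
  move=> A mA; split.
  - rewrite -(c0 A mA).1 -Pi1; last exact: measurableX.
    rewrite /q /distribution /pushforward; congr (Pi _).
    by apply/seteqP; split => -[[a b] [c f]] /=; tauto.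
  - rewrite -(c1 A mA).2 -Pi2; last exact: measurableX.
    rewrite /q /distribution /pushforward; congr (Pi _).
    by apply/seteqP; split => -[[a b] [c f]] /=; tauto.
have md2 : measurable_fun setT d2 := measurable_dist_sqr.
have d20 z : (0 <= d2 z)%E by rewrite lee_fin sqr_ge0.
have wle : (w%:E <= \int[Pi]_z d2 (z.1.1, z.2.2))%E.
  rewrite -wE (_ : \int[Pi]_z d2 (z.1.1, z.2.2) = \int[q]_z d2 z)%E; last first.
    exact: (@ge0_integral_image _ _ _ _ _ Pi q).
  by apply: ereal_inf_lbound; exists q.
have mOO : measurable [set z : W | O z.1.2].
  rewrite (_ : [set _ | _] = (setT `*` O) `*` setT).
    by apply: measurableX => //; exact: measurableX.
  by apply/seteqP; split => -[[a b] [c f]] /=; tauto.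
have intA : (\int[Pi]_z d2 z.1 = \int[q0]_z d2 z)%E.
  apply: (@ge0_integral_image _ _ _ _ _ Pi q0 fst) => // E mE; rewrite -Pi1//; congr (Pi _).
  by apply/seteqP; split => -[a b] /=; tauto.
have intB : (\int[Pi]_z d2 z.2 = \int[q1]_z d2 z)%E.
  apply: (@ge0_integral_image _ _ _ _ _ Pi q1 snd) => // E mE; rewrite -Pi2//; congr (Pi _).
  by apply/seteqP; split => -[a b] /=; tauto.
have PiO : Pi [set z : W | O z.1.2] = (fine (nt O))%:E.
  rewrite fineK ?fin_num_measure// -(c0 O mO).2 -Pi1; last exact: measurableX.
  by congr (Pi _); apply/seteqP; split => -[[a b] [c f]] /=; tauto.
have intO : (\int[Pi]_z (\1_[set z : W | O z.1.2] z)%:E = (fine (nt O))%:E)%E.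
  by rewrite integral_indic// setIT; exact: PiO.
have intc (k : R) : (\int[Pi]_z k%:E = k%:E)%E.
  by rewrite integral_cst// [X in (_ * X)%E](probability_setT Pi) mule1.
have md2A : measurable_fun setT (fun z : W => d2 z.1) by exact: measurableT_comp.
have md2B : measurable_fun setT (fun z : W => d2 z.2) by exact: measurableT_comp.
have md2C : measurable_fun setT (fun z : W => d2 (z.1.1, z.2.2)) by exact: (measurableT_comp md2).
pose f (z : W) : \bar R :=
  (d2 (z.1.1, z.2.2) + (eta ^+ 2 / 2)%:E * (\1_[set z : W | O z.1.2] z)%:E)%E.
pose g (z : W) : \bar R :=
  (t^-1%:E * d2 z.1 + (((1 + e) / (1 - t))%:E * d2 z.2 + ((e ^+ 2 + e) / (1 - t))%:E))%E.
have eta2 : 0 <= eta ^+ 2 / 2 by rewrite divr_ge0// sqr_ge0.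
have ti0 : 0 <= t^-1 by rewrite invr_ge0 ltW.
have k0 : 0 <= (1 + e) / (1 - t) by rewrite divr_ge0//; lra.
have k1 : 0 <= (e ^+ 2 + e) / (1 - t) by rewrite divr_ge0//; nra.
have m1 : measurable_fun setT
    (fun z : W => ((eta ^+ 2 / 2)%:E * (\1_[set z : W | O z.1.2] z)%:E)%E).
  by apply: emeasurable_funM => //; apply/measurable_EFinP; exact: measurable_indic.
have m2 : measurable_fun setT (fun z : W => (t^-1%:E * d2 z.1)%E) by exact: emeasurable_funM.
have m3 : measurable_fun setT
    (fun z : W => (((1 + e) / (1 - t))%:E * d2 z.2)%E) by exact: emeasurable_funM.
(* The pointwise inequality can fail only if the first point misses [S0], the last one misses [S1],
   or the middle points are more than [e] apart, and each of these events is null. *)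
have fg : (\int[Pi]_z f z <= \int[Pi]_z g z)%E.
  apply: ae_ge0_le_integral => //.
  - by move=> z _; rewrite /f adde_ge0// -EFinM lee_fin mulr_ge0.
  - exact: emeasurable_funD.
  - by move=> z _; rewrite /g adde_ge0 ?mule_ge0// adde_ge0 ?mule_ge0.
  - by apply: emeasurable_funD => //; exact: emeasurable_funD.
  - exists (((~` S0 `*` setT) `*` setT) `|` (setT `*` (setT `*` ~` S1)) `|`
       [set z : W | e < d z.1.2 z.2.1]).
    have mS0' : measurable ((~` S0 `*` setT) `*` setT : set W).
      by apply: measurableX => //; apply: measurableX => //; exact: measurableC.
    have mS1' : measurable (setT `*` (setT `*` ~` S1) : set W).
      by apply: measurableX => //; apply: measurableX => //; exact: measurableC.
    have mB : measurable [set z : W | e < d z.1.2 z.2.1].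
      have mm : measurable_fun setT (fun z : W => d z.1.2 z.2.1).
        have mm2 : measurable_fun setT (fun z : W => (z.1.2, z.2.1)).
          by apply: measurable_fun_pair; apply: measurableT_comp.
        exact: (measurableT_comp (measurable_dist dm mX sd) mm2).
      rewrite -[X in measurable X]setTI.
      rewrite (_ : [set _ | _] = (fun z : W => d z.1.2 z.2.1) @^-1` `]e, +oo[).
        exact: mm.
      by apply/seteqP; split => z /=; rewrite in_itv/= andbT.
    have e1 : Pi ((~` S0 `*` setT) `*` setT) = 0%E.
      rewrite Pi1 ?(c0 _ (measurableC mS0)).1//.
      by apply: measurableX => //; exact: measurableC.
    have e2 : Pi (setT `*` (setT `*` ~` S1)) = 0%E.
      rewrite Pi2 ?(c1 _ (measurableC mS1)).2//.
      by apply: measurableX => //; exact: measurableC.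
    split.
    + by apply: measurableU => //; exact: measurableU.
    + apply: measure_negligible; first by apply: measurableU => //; exact: measurableU.
      have ng1 : Pi.-negligible ((~` S0 `*` setT) `*` setT).
        by apply/(negligibleP _ mS0'); exact: e1.
      have ng2 : Pi.-negligible (setT `*` (setT `*` ~` S1)).
        by apply/(negligibleP _ mS1'); exact: e2.
      apply: (negligibleU (negligibleU ng1 ng2)).
      by apply/(negligibleP _ mB); exact: PiB.
    + move=> [[z0 y] [y' z1]] /= H; apply: contrapT => NH; apply: H => _.
      have S0z : S0 z0 by apply: contrapT => h; apply: NH; left; left.
      have S1z : S1 z1 by apply: contrapT => h; apply: NH; left; right.
      have yy : d y y' <= e by rewrite leNgt; apply/negP => h; apply: NH; right.
      rewrite /f /g /d2 /= -!EFinM -!EFinD lee_fin indicE.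
      have cab : d z0 z1 <= d z0 y + (d y' z1 + e).
        by have := dt z0 y z1; have := dt y y' z1; move: yy; clear; lra.
      apply: (@glued_cost_ineq _ t e L eta) => //; first exact: SL.
      by rewrite inE; exact: SO.
move: fg; rewrite /f /g ge0_integralD//; last by move=> z _; rewrite -EFinM lee_fin mulr_ge0.
rewrite ge0_integralZl_EFin//; last by apply/measurable_EFinP; exact: measurable_indic.
rewrite intO.
rewrite ge0_integralD//; last 3 first.
- by move=> z _; rewrite mule_ge0.
- by move=> z _; rewrite adde_ge0 ?mule_ge0.
- exact: emeasurable_funD.
rewrite ge0_integralD//; last first.
  by move=> z _; rewrite mule_ge0.
rewrite !ge0_integralZl_EFin// intc intA intB => fg.
rewrite -lee_fin EFinD EFinM.
apply: (@le_trans _ _ (\int[Pi]_z d2 (z.1.1, z.2.2) + (eta ^+ 2 / 2)%:E * (fine (nt O))%:E)%E).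
  by rewrite leeD2r.
apply: (le_trans fg).
rewrite EFinD EFinD !EFinM; apply: leeD; first by rewrite lee_wpmul2l.
by apply: leeD => //; rewrite lee_wpmul2l.
Qed.

(** When [e] tends to 0 the right side of [interpolation_bound] tends to [t w + (1 - t) w = w],
    which leaves no room for a positive mass of [O]. The limit is replaced by one sufficiently small
    [e]. *)
Lemma interpolation_support (nu0 nt nu1 : probability X R) (S0 S1 O : set X)
    (t L eta w : R) :
  0 < t < 1 -> 0 < eta ->
  measurable S0 -> measurable S1 -> measurable O ->
  nu0 (~` S0) = 0%E -> nu1 (~` S1) = 0%E ->
  (forall x y, S0 x -> S1 y -> d x y <= L) ->
  (forall x y, S0 x -> O y -> t * L + eta <= d x y) ->
  W2sq d nu0 nu1 = w%:E ->
  W2sq d nu0 nt = (t ^+ 2 * w)%:E ->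
  W2sq d nt nu1 = ((1 - t) ^+ 2 * w)%:E ->
  nt O = 0%E.
Proof.
move=> t01 eta0 mS0 mS1 mO nuS0 nuS1 SL SO wE w0E w1E.
have [t0 t1] := andP t01.
have ntfin : nt O \is a fin_num by exact: fin_num_measure.
rewrite -(fineK ntfin); congr EFin.
set p := fine (nt O); have p0 : 0 <= p by exact: fine_ge0.
apply/eqP; rewrite eq_le p0 andbT leNgt; apply/negP => pgt.
(* For [e <= 1] this bounds the coefficient of [e] in the excess of the right side over [w]; the 4
   comes from [2 + 2 e]. The choice of [e] below makes [e K] at most half of the term to be
   contradicted. *)
pose K := t^-1 + (1 - t) * `|w| + 4 / (1 - t).
have ti : 0 < t^-1 by rewrite invr_gt0.
have t1i : 0 < (1 - t)^-1 by rewrite invr_gt0; lra.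
have K0 : 0 < K.
  rewrite /K; have : 0 <= (1 - t) * `|w| by rewrite mulr_ge0//; lra.
  have : 0 < 4 / (1 - t) by rewrite mulr_gt0.
  lra.
have pe : 0 < eta ^+ 2 / 2 * p by rewrite mulr_gt0// divr_gt0// exprn_gt0.
pose e := Num.min 1 (eta ^+ 2 / 2 * p / (2 * K)).
have e0 : 0 < e by rewrite lt_min ltr01/= divr_gt0// mulr_gt0.
have e1 : e <= 1 by rewrite ge_min lexx.
have eK : e * K <= eta ^+ 2 / 2 * p / 2.
  have : e <= eta ^+ 2 / 2 * p / (2 * K) by rewrite ge_min lexx orbT.
  rewrite -(ler_pM2r K0) => /le_trans; apply.
  by rewrite le_eqVlt; apply/orP; left; apply/eqP; field; lra.
have := interpolation_bound t01 eta0 e0 mS0 mS1 mO nuS0 nuS1 SL SO wE w0E w1E.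
rewrite -/p.
have -> : t^-1 * (t ^+ 2 * w + e) +
    ((1 + e) / (1 - t) * ((1 - t) ^+ 2 * w + e) + (e ^+ 2 + e) / (1 - t)) =
    w + e * (t^-1 + (1 - t) * w + (2 + 2 * e) / (1 - t)).
  by field; lra.
have : t^-1 + (1 - t) * w + (2 + 2 * e) / (1 - t) <= K.
  rewrite /K; apply: lerD; first apply: lerD => //.
    by rewrite ler_pM2l ?ler_norm//; lra.
  by rewrite ler_pM2r//; lra.
move=> h; have := ler_wpM2l (ltW e0) h; lra.
Qed.

End interpolation_support.

(** * Densities, Lebesgue decomposition and the Renyi functional *)

Section density_measure.
Local Open Scope ereal_scope.
Context (dX : measure_display) (X : measurableType dX) (R : realType).
Context (mu : {measure set X -> \bar R}) (rho : X -> R).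
Context (mrho : measurable_fun setT rho) (rho0 : forall x, (0 <= rho x)%R).

(* The proof arguments are only there to attach the measure structure. *)
Definition density_measure of measurable_fun setT rho
    & (forall x, (0 <= rho x)%R) : set X -> \bar R :=
  fun A => \int[mu]_(x in A) (rho x)%:E.

Local Notation nu := (density_measure mrho rho0).

Let nu0 : nu set0 = 0. Proof. exact: integral_set0. Qed.

Let nu_ge0 A : 0 <= nu A.
Proof. by apply: integral_ge0 => x _; rewrite lee_fin. Qed.

Let nu_sigma_additive : semi_sigma_additive nu.
Proof.
move=> /= F mF tF mUF; rewrite /density_measure; apply: cvg_toP.
  apply: ereal_nondecreasing_is_cvgn => m n mn.
  by apply: lee_sum_nneg_natr => // k _ _; exact: nu_ge0.
rewrite ge0_integral_bigcup//=.
- by apply/measurable_EFinP; exact: measurable_funTS.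
- by move=> x _; rewrite lee_fin.
Qed.

HB.instance Definition _ := isMeasure.Build _ _ _ nu nu0 nu_ge0 nu_sigma_additive.

End density_measure.

Lemma has_density_exists (dX : measure_display) (X : measurableType dX)
    (R : realType) (mu : {measure set X -> \bar R}) (rho : X -> R) :
  measurable_fun setT rho -> (forall x, 0 <= rho x) ->
  (\int[mu]_x (rho x)%:E = 1)%E ->
  exists nu : probability X R, has_density mu nu rho.
Proof.
move=> mrho rho0 rho1.
pose P : set X -> \bar R := density_measure mu mrho rho0.
pose PM := Measure.on P.
pose PB := Measure_isProbability.Build _ _ _ P rho1.
pose nu : probability X R := HB.pack P PM PB.
by exists nu; split.
Qed.

Section lebesgue_decomposition.
Local Open Scope ereal_scope.
Context (dX : measure_display) (X : measurableType dX) (R : realType).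
Context (mu : {measure set X -> \bar R}) (nu : probability X R).

(** By exhaustion: [Z] is a countable union of [mu]-null sets whose [nu]-masses approach the
    supremum over all [mu]-null sets. A [mu]-null set outside [Z] with positive mass would push the
    union beyond that supremum. *)
Lemma maximal_null_set : exists Z : set X, [/\ measurable Z, mu Z = 0 &
  forall A, measurable A -> mu A = 0 -> A `<=` ~` Z -> nu A = 0].
Proof.
pose S := [set nu Z | Z in [set Z | measurable Z /\ mu Z = 0]].
have S0 : S 0 by exists set0; rewrite ?measure0.
have Sfin : ereal_sup S \is a fin_num.
  rewrite fin_numElt; apply/andP; split.
    by apply: lt_le_trans (ereal_sup_ubound S0).
  apply: (@le_lt_trans _ _ 1); last by rewrite ltry.
  by apply: ge_ereal_sup => _ [Z [mZ _] <-]; exact: probability_le1.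
have h k : {Z | [/\ measurable Z, mu Z = 0 & ereal_sup S - (k.+1%:R^-1)%:E < nu Z]}.
  apply: cid; have k0 : (0 < k.+1%:R^-1 :> R)%R by rewrite invr_gt0.
  have [_ [Z [mZ Z0] <-] hZ] := ub_ereal_sup_adherent k0 Sfin.
  by exists Z.
pose Z := \bigcup_k (sval (h k)).
have mh k : measurable (sval (h k)) by case: (h k) => ? [].
have mZ : measurable Z by exact: bigcupT_measurable.
have muZ : mu Z = 0.
  apply: measure_negligible => //; apply: negligible_bigcup => k.
  by apply/negligibleP => //; case: (h k) => ? [].
exists Z; split => // A mA A0 AZ.
have ZA0 : mu (Z `|` A) = 0.
  apply: measure_negligible; first exact: measurableU.
  by apply: negligibleU; exact/negligibleP.
have le1 : nu (Z `|` A) <= ereal_sup S.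
  by apply: ereal_sup_ubound; exists (Z `|` A) => //; split => //; exact: measurableU.
have ge1 : ereal_sup S <= nu Z.
  apply/lee_addgt0Pr => e e0.
  have [k] := ltr_add_invr e0; rewrite add0r => ke.
  have [mZk Zk0 hZk] := svalP (h k).
  have : nu (sval (h k)) <= nu Z.
    by apply: le_measure; rewrite ?inE// => x Zx; exists k.
  move=> ZkZ; move: hZk; rewrite lteBlDr// => /ltW /le_trans; apply.
  by apply: leeD => //; rewrite lee_fin ltW.
have E : nu (Z `|` A) = nu Z + nu A.
  apply: measureU => //; apply/seteqP; split => // x [Zx Ax]; exact: (AZ _ Ax).
rewrite E in le1.
have nuZfin : nu Z \is a fin_num by exact: fin_num_measure.
have : nu A <= 0.
  have := le_trans le1 ge1.
  by rewrite -[leRHS]adde0 leeD2lE.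
by move=> h0; apply/eqP; rewrite eq_le h0/= measure_ge0.
Qed.

(** Since [renyi_le] quantifies over decompositions of the measure, it yields a bound only once a
    decomposition is exhibited. The singular part is [nu] on a maximal null set [Z]; off [Z],
    Radon-Nikodym applies to [mu] restricted to [B], where it is finite and where [nu] is
    carried. *)
Lemma lebesgue_decomposition (B : set X) : measurable B -> mu B < +oo ->
  nu (~` B) = 0 ->
  exists (rho : X -> R) (nus : {measure set X -> \bar R}),
    [/\ measurable_fun setT rho, (forall x, 0 <= rho x)%R,
        (forall x, ~ B x -> rho x = 0%R),
        (exists Z : set X, [/\ measurable Z, mu Z = 0 & nus (~` Z) = 0]) &
        (forall A : set X, measurable A ->
          nu A = \int[mu]_(x in A) (rho x)%:E + nus A)].
Proof.
move=> mB Boo nuB.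
have [Z [mZ Z0 Zmax]] := maximal_null_set.
have mCZ := measurableC mZ.
have nuCZ : nu (~` Z) < +oo by rewrite ltey_eq fin_num_measure.
pose mu' : {finite_measure set X -> \bar R} := mfrestr mB Boo.
pose nu' : {finite_measure set X -> \bar R} := mfrestr mCZ nuCZ.
have nuI A : measurable A -> nu A = nu (A `&` B).
  move=> mA; have mAB := measurableI _ _ mA mB.
  have mAC := measurableI _ _ mA (measurableC mB).
  have E0 : nu (A `&` ~` B) = 0.
    apply/eqP; rewrite eq_le measure_ge0 andbT -nuB le_measure// inE//.
    exact: measurableC.
  have : nu ((A `&` B) `|` (A `&` ~` B)) = nu (A `&` B) + nu (A `&` ~` B).
    apply: measureU => //; apply/seteqP; split => // x [[_ Bx] [_ /(_ Bx)]] //.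
  by rewrite E0 adde0 -setIUr setUv setIT.
(* A set null for [mu] on [B] leaves, after removing [Z], a [mu]-null set disjoint from [Z], which
   maximality makes [nu]-null. *)
have dom : nu' `<< mu'.
  apply/null_content_dominatesP => A mA; rewrite /= /mfrestr /mrestr => A0.
  rewrite nuI; last exact: measurableI.
  apply: Zmax.
  - by apply: measurableI => //; exact: measurableI.
  - apply/eqP; rewrite eq_le measure_ge0 andbT -A0 le_measure// ?inE.
    + by apply: measurableI => //; exact: measurableI.
    + exact: measurableI.
    + by move=> x [[]].
  - by move=> x [[]].
have [f [f0 ffin fint nuf]] := radon_nikodym_sigma_finite dom.
have mf : measurable_fun setT f by case/integrableP: fint.
pose rho := (fine \o f) \_ B.
exists rho, (mrestr nu mZ); split => //.
- apply/(measurable_restrictT _ _).1 => //.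
  apply: measurable_funTS; apply: measurableT_comp => //.
- by move=> x; rewrite /rho patchE; case: ifPn => // _; rewrite /= fine_ge0.
- by move=> x Bx; rewrite /rho patchE memNset.
- by exists Z; split => //; rewrite /= /mrestr setICl measure0.
move=> A mA.
have -> : \int[mu]_(x in A) (rho x)%:E = nu' A.
  have -> : nu' A = nu' (A `&` B).
    rewrite /nu'/= /mfrestr /mrestr nuI; last exact: measurableI.
    by rewrite setIAC.
  rewrite nuf; last exact: measurableI.
  rewrite (_ : \int[mu']_(x in A `&` B) f x = \int[mu]_(x in A `&` B) f x); last first.
    apply: eq_measure_integral => C mC CAB.
    by rewrite /mu'/= /mfrestr /mrestr setIidl// => x /CAB[].
  rewrite integral_mkcondr; apply: eq_integral => x _.
  rewrite /rho !patchE; case: ifPn => // _; by rewrite /= fineK.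
have mAC := measurableI _ _ mA mCZ; have mAZ := measurableI _ _ mA mZ.
have : nu ((A `&` ~` Z) `|` (A `&` Z)) = nu (A `&` ~` Z) + nu (A `&` Z).
  by apply: measureU => //; apply/seteqP; split => // x [[_ +] [_ Zx]] => /(_ Zx).
by rewrite -setIUr setUC setUv setIT.
Qed.

End lebesgue_decomposition.

(** The right side is the tangent line at [r = 1/v] of the concave function [r^(1 - 1/N)]. It comes
    from Young's inequality for [(v r)^(1 - 1/N)] and 1, with exponents [1/(1 - 1/N)] and [N]. *)
Lemma powR_young (R : realType) (N v r : R) : 1 < N -> 0 < v -> 0 <= r ->
  r `^ (1 - N^-1) <= v `^ N^-1 / v * ((1 - N^-1) * v * r + N^-1).
Proof.
move=> N1 v0 r0.
have N0 : 0 < N by lra.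
have iN : 0 < N^-1 < 1 by rewrite invr_gt0 N0/= invf_lt1.
have a0 : 0 < 1 - N^-1 by lra.
have vr : 0 <= v * r by rewrite mulr_ge0// ltW.
have := @conjugate_powR R ((v * r) `^ (1 - N^-1)) 1 (1 - N^-1)^-1 N
  (powR_ge0 _ _) ler01 _ N0 _.
rewrite invr_gt0 a0 invrK subrK => /(_ isT erefl).
rewrite mulr1 -powRrM divff ?gt_eqF// powRr1// powR1 mul1r.
rewrite powRM ?(ltW v0)// => h.
have vp : 0 < v `^ (1 - N^-1) by rewrite powR_gt0.
have E : v `^ N^-1 / v = (v `^ (1 - N^-1))^-1.
  rewrite -powRN opprB powRB; last by rewrite (gt_eqF v0) implybT.
  by rewrite powRr1// ltW.
rewrite E mulrC ler_pdivlMr// mulrC; apply: le_trans h _.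
by rewrite lerD2r le_eqVlt; apply/orP; left; apply/eqP; ring.
Qed.

(** Jensen's inequality, obtained by integrating over [B] the tangent line at the uniform density
    [1/v]: as [rho] has mass at most 1 and [B] has mass [v], the result is [v^(1/N)]. *)
Lemma renyi_le_support (dX : measure_display) (X : measurableType dX)
    (R : realType) (mu : {measure set X -> \bar R}) (nu : probability X R)
    (B : set X) (N v : R) (c : \bar R) :
  1 < N -> measurable B -> mu B = v%:E -> 0 < v -> nu (~` B) = 0%E ->
  renyi_le mu N nu (- c)%E -> (c <= (v `^ N^-1)%:E)%E.
Proof.
move=> N1 mB muB v0 nuB H.
have Boo : (mu B < +oo)%E by rewrite muB ltry.
have [rho [nus [mrho rho0 rhoB Zs nuE]]] := lebesgue_decomposition mB Boo nuB.
have := H rho nus mrho rho0 Zs nuE; rewrite leeN2 => /le_trans; apply.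
have N0 : 0 < N by lra.
have iN : 0 < N^-1 < 1 by rewrite invr_gt0 N0/= invf_lt1.
have a0 : 0 < 1 - N^-1 by lra.
(* The density vanishes off [B], and 0 to the positive power [1 - 1/N] is 0. *)
have -> : (\int[mu]_x ((rho x) `^ (1 - N^-1))%:E =
    \int[mu]_(x in B) ((rho x) `^ (1 - N^-1))%:E)%E.
  rewrite [RHS]integral_mkcond; apply: eq_integral => x _.
  rewrite patchE; case: ifPn => // /negP xB; rewrite rhoB ?powR0 ?gt_eqF//.
  by move=> Bx; apply: xB; rewrite inE.
pose al := v `^ N^-1 / v.
have al0 : 0 < al by rewrite divr_gt0// powR_gt0.
have c1 : 0 <= al * (1 - N^-1) * v.
  by apply: mulr_ge0; [apply: mulr_ge0|]; exact: ltW.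
have c2 : 0 <= al * N^-1 by apply: mulr_ge0; lra.
apply: (@le_trans _ _ (\int[mu]_(x in B)
   ((al * (1 - N^-1) * v)%:E * (rho x)%:E + (al * N^-1)%:E))%E).
  apply: ge0_le_integral => //.
  - by move=> x _; rewrite lee_fin powR_ge0.
  - apply/measurable_EFinP; apply: measurable_funTS.
    exact: (measurableT_comp (measurable_powR _) mrho).
  - apply: emeasurable_funD => //; apply: emeasurable_funM => //.
    by apply/measurable_EFinP; exact: measurable_funTS.
  - move=> x _; rewrite -EFinM -EFinD lee_fin.
    apply: le_trans (powR_young N1 v0 (rho0 x)) _.
    by rewrite -/al le_eqVlt; apply/orP; left; apply/eqP; ring.
have mrhoB : measurable_fun B (EFin \o rho).
  by apply/measurable_EFinP; exact: measurable_funTS.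
rewrite ge0_integralD//; last 2 first.
- by move=> x _; rewrite -EFinM lee_fin mulr_ge0.
- by apply: emeasurable_funM.
rewrite ge0_integralZl_EFin//; last first.
- by move=> x _; rewrite lee_fin.
rewrite integral_cst// muB.
have i1 : (\int[mu]_(x in B) (rho x)%:E <= 1)%E.
  apply: (@le_trans _ _ (nu B)); last exact: probability_le1.
  by rewrite (nuE _ mB) leeDl.
apply: (@le_trans _ _ ((al * (1 - N^-1) * v)%:E * 1 + (al * N^-1)%:E * v%:E)%E).
  rewrite leeD2r// lee_wpmul2l// lee_fin.
rewrite mule1 -EFinM -EFinD lee_fin /al le_eqVlt; apply/orP; left; apply/eqP.
by field; rewrite !gt_eqF.
Qed.

(** * Comparison of ball volumes *)

Import HBNNSimple.

(** The integral of a nonnegative function is a supremum over simple functions below it, and those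
    below [c] times the indicator of [E] are also below [f]. No measurability of [f] enters, so the
    integrand of [CD] can be inserted directly. *)
Lemma ge0_integral_ge_indic (dT : measure_display) (T : measurableType dT)
    (R : realType) (m : {measure set T -> \bar R}) (E : set T) (c : R)
    (f : T -> \bar R) :
  measurable E -> 0 <= c -> (forall x, 0 <= f x)%E ->
  (forall x, E x -> c%:E <= f x)%E -> (c%:E * m E <= \int[m]_x f x)%E.
Proof.
move=> mE c0 f0 cf.
pose h : {nnsfun T >-> R} := scale_nnsfun (indic_nnsfun R mE) c0.
have hE x : h x = c * \1_E x by [].
have -> : (c%:E * m E = \int[m]_x (h x)%:E)%E.
  under eq_integral do rewrite hE EFinM.
  by rewrite ge0_integralZl_EFin ?integral_indic ?setIT// => *; apply/measurable_EFinP.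
rewrite ge0_integralTE//; last first.
  by move=> x; rewrite hE lee_fin mulr_ge0.
rewrite ge0_integralTE//.
apply: ereal_sup_le => _ /= [g gh <-]; exists g => // x.
have gx : ((g x)%:E <= (c * \1_E x)%:E)%E := gh x.
apply: (le_trans gx); rewrite indicE.
have [xE|xE] := boolP (x \in E); last by rewrite mulr0.
by rewrite mulr1 cf//; move: xE; rewrite inE.
Qed.

Lemma tauKN_ge0 (R : realType) (K N theta t : R) : (0 <= tauKN K N theta t)%E.
Proof.
rewrite /tauKN; case: sigmaKN => [s| |]; first by rewrite lee_fin mulr_ge0 ?powR_ge0.
- by rewrite mule_ge0// lee_fin powR_ge0.
- by rewrite mule_ge0// lee_fin powR_ge0.
Qed.

(** [CD] identifies the ends of the interpolation with [nu0] and [nu1] only through their values on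
    measurable sets; this carries the identification over to transport costs. *)
Lemma W2sq_eq (dX : measure_display) (X : measurableType dX) (R : realType)
    (d : X -> X -> R) (nu0 nu0' nu1 nu1' : probability X R) :
  (forall A, measurable A -> nu0 A = nu0' A) ->
  (forall A, measurable A -> nu1 A = nu1' A) ->
  W2sq d nu0 nu1 = W2sq d nu0' nu1'.
Proof.
move=> e0 e1; congr ereal_inf; apply/seteqP; split => _ [q qc <-]; exists q => // A mA.
- by rewrite -e0// -e1//; exact: qc.
- by rewrite e0// e1//; exact: qc.
Qed.

Lemma finite_second_moment_bounded (dX : measure_display) (X : measurableType dX)
    (R : realType) (d : X -> X -> R) (nu : probability X R) (x : X) (r : R) (S : set X) :
  measurable_fun setT (d x) -> (forall y, 0 <= d x y) -> measurable S ->
  nu (~` S) = 0%E -> (forall y, S y -> d x y <= r) -> finite_second_moment d nu.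
Proof.
move=> md d0 mS nuS Sr; exists x.
have m2 : measurable_fun setT (fun y => ((d x y) ^+ 2)%:E).
  by apply/measurable_EFinP; exact: measurable_funX.
rewrite (@ge0_negligible_integral _ _ _ _ setT (~` S))//; last 2 first.
- exact: measurableC.
- by move=> y _; rewrite lee_fin sqr_ge0.
rewrite setTD setCK.
apply: (@le_lt_trans _ _ (\int[nu]_(y in S) (cst (r ^+ 2)%:E) y)%E).
  apply: ge0_le_integral => //.
  - by move=> y _; rewrite lee_fin sqr_ge0.
  - exact: measurable_funTS.
  - by move=> y Sy; rewrite lee_fin ler_pXn2r ?nnegrE ?Sr// (le_trans (d0 y))// Sr.
rewrite integral_cst// ltey_eq fin_numM// fin_num_measure//.
Qed.

(* Truncated so as to bound [1 + kappa / 6 * d z y ^+ 2] from below for every [z]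
   in [cball d x delta]. *)
Definition ball_weight (R : realType) (X : Type) (d : X -> X -> R) (kappa : R)
    (x : X) (delta : R) (y : X) : R :=
  1 + kappa / 6 * Num.max (d x y - delta) 0 ^+ 2.

(** * The ball inequality drawn from CD at a fixed time *)

Section ball_inequality.
Context (dX : measure_display) (X : measurableType dX) (R : realType).
Context (d : X -> X -> R) (mu : {measure set X -> \bar R}) (n : nat) (kappa : R).
Context (n2 : (2 <= n)%N) (kappa0 : 0 <= kappa) (mm : mm_space d mu)
  (cd : CD d mu kappa n%:R).

Let dm : is_metric d. Proof. by case: mm. Qed.
Let sd : d_separable d. Proof. by case: mm. Qed.
Let mX : (@measurable _ X : set (set X)) = <<s [set A | d_open d A] >>.
Proof. by case: mm => _ _ _ _ []. Qed.

Local Notation gd := (ball_weight d kappa).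

Lemma measurable_ball_weight x delta : measurable_fun setT (gd x delta).
Proof.
apply: measurable_funD => //; apply: measurable_funM => //.
apply: measurable_funX; apply: measurable_maxr => //.
apply: measurable_funB => //; exact: measurable_dist_l.
Qed.

Lemma ball_weight_ge1 x delta y : 1 <= gd x delta y.
Proof. by rewrite lerDl mulr_ge0// ?divr_ge0// sqr_ge0. Qed.

Lemma has_density_null (nu : probability X R) (rho : X -> R) (S : set X) :
  has_density mu nu rho -> measurable S -> (forall y, ~ S y -> rho y = 0) ->
  nu (~` S) = 0%E.
Proof.
move=> [_ _ h] mS r0; rewrite h; last exact: measurableC.
by apply: integral0_eq => y /= Sy; rewrite r0.
Qed.

(** [CD] is tested on the uniform measure of the [delta]-ball and on the measure on [A] with density
    proportional to [ball_weight]. With [G] the total weight of [A], this gives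
    [t (1 - t^2) G^(1/n) <= mu(B)^(1/n)] for the ball [B] carrying the interpolating measure, and
    the [n]-th power is the claim. *)
Lemma ball_inequality (x : X) (A : set X) (r delta t : R) :
  0 < r -> 0 < delta -> 0 < t < 1 -> kappa * (r + delta) ^+ 2 <= 1 ->
  measurable A -> A `<=` cball d x r -> (0 < mu A < +oo)%E ->
  (0 < mu (cball d x delta) < +oo)%E ->
  (((t * (1 - t ^+ 2)) ^+ n)%:E * \int[mu]_(y in A) (gd x delta y)%:E <=
    mu (cball d x (t * r + 3 * delta)))%E.
Proof.
move=> r0 dl0 t01 krd mA Ar /andP[A0 Aoo] /andP[D0 Doo].
have [d0 d00 ds dt] := dm.
have [t0 t1] := andP t01.
set D := cball d x delta; set B := cball d x (t * r + 3 * delta).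
have mD : measurable D by exact: measurable_cball.
have mB : measurable B by exact: measurable_cball.
have mg := measurable_ball_weight x delta; have g1 := ball_weight_ge1 x delta.
have [Boo|Boo] := eqVneq (mu B) +oo%E; first by rewrite Boo leey.
have Bfin : mu B \is a fin_num.
  by rewrite ge0_fin_numE// lt_neqAle Boo leey.
have tr : 0 < t * r by rewrite mulr_gt0.
have v0 : 0 < fine (mu B).
  rewrite fine_gt0//; apply/andP; split; last by rewrite lt_neqAle Boo leey.
  apply: (lt_le_trans D0); apply: le_measure; rewrite ?inE//.
  by move=> y; rewrite /D /B /cball/= => h; lra.
have Afin : mu A \is a fin_num by rewrite ge0_fin_numE.
have Dfin : mu D \is a fin_num by rewrite ge0_fin_numE.
set Gam := (\int[mu]_(y in A) (gd x delta y)%:E)%E.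
have mgA : measurable_fun A (fun y => (gd x delta y)%:E).
  by apply/measurable_EFinP; exact: measurable_funTS.
have Gge : (mu A <= Gam)%E.
  rewrite -[leLHS]mul1e -integral_cst//; apply: ge0_le_integral => //.
  by move=> y _; rewrite lee_fin.
have Goo : (Gam < +oo)%E.
  apply: (@le_lt_trans _ _ (\int[mu]_(y in A) (cst (1 + kappa / 6 * r ^+ 2)%:E) y)%E).
    apply: ge0_le_integral => //.
    - by move=> y _; rewrite lee_fin (le_trans ler01).
    - move=> y Ay; rewrite lee_fin /ball_weight lerD2l ler_wpM2l// ?divr_ge0//.
      have dy : d x y <= r by exact: Ar.
      rewrite ler_pXn2r ?nnegrE ?le_max ?lexx ?orbT// ?(ltW r0)//.
      by rewrite ge_max (ltW r0) andbT; lra.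
  by rewrite integral_cst// ltey_eq fin_numM.
have Gfin : Gam \is a fin_num.
  by rewrite ge0_fin_numE// (le_trans _ Gge).
pose G := fine Gam.
have G0 : 0 < G by rewrite fine_gt0// Goo andbT (lt_le_trans A0).
pose m := fine (mu D).
have m0 : 0 < m by rewrite fine_gt0// D0.
pose rho0 := fun y => m^-1 * \1_D y : R.
(* With this density [rho1^(-1/n)] cancels the factor [gd^(1/n)] of [tauKN_ge]. *)
pose rho1 := fun y => G^-1 * (gd x delta y * \1_A y) : R.
have mi0 : 0 < m^-1 by rewrite invr_gt0.
have Gi0 : 0 < G^-1 by rewrite invr_gt0.
have [nu0 nu0d] : exists nu : probability X R, has_density mu nu rho0.
  apply: has_density_exists.
  - by apply: measurable_funM => //; exact: measurable_indic.
  - by move=> y; rewrite mulr_ge0// ltW.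
  - under eq_integral do rewrite EFinM.
    rewrite ge0_integralZl_EFin ?(ltW mi0)//; last first.
      by apply/measurable_EFinP; exact: measurable_indic.
    by rewrite integral_indic// setIT -[X in (_ * X)%E]fineK// -EFinM mulVf// gt_eqF.
have [nu1 nu1d] : exists nu : probability X R, has_density mu nu rho1.
  apply: has_density_exists.
  - apply: measurable_funM => //; apply: measurable_funM => //; exact: measurable_indic.
  - by move=> y; rewrite mulr_ge0 ?(ltW Gi0)// mulr_ge0// (le_trans ler01).
  - under eq_integral do rewrite EFinM.
    rewrite ge0_integralZl_EFin ?(ltW Gi0)//; last 2 first.
    + by move=> y _; rewrite lee_fin mulr_ge0// (le_trans ler01).
    + by apply/measurable_EFinP; apply: measurable_funM => //; exact: measurable_indic.
    rewrite (_ : (\int[mu]_y (gd x delta y * \1_A y)%:E)%E = Gam); last first.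
      rewrite /Gam [RHS]integral_mkcond; apply: eq_integral => y _.
      rewrite patchE indicE; case: ifPn => _; by rewrite ?mulr1 ?mulr0.
    by rewrite -[X in (_ * X)%E]fineK// -EFinM mulVf// gt_eqF.
have nu0D : nu0 (~` D) = 0%E.
  apply: (has_density_null nu0d) => // y Dy.
  by rewrite /rho0 indicE memNset// mulr0.
have nu1A : nu1 (~` A) = 0%E.
  apply: (has_density_null nu1d) => // y Ay.
  by rewrite /rho1 indicE memNset// !mulr0.
have mdx := measurable_dist_l dm mX x.
have fs0 : finite_second_moment d nu0.
  exact: (@finite_second_moment_bounded _ _ _ _ _ x delta D).
have fs1 : finite_second_moment d nu1.
  exact: (@finite_second_moment_bounded _ _ _ _ _ x r A).
have [q [Gt [qc qopt [Gend _ Gspeed] ren]]] := cd nu0d nu1d fs0 fs1.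
have DAL y z : D y -> A z -> d y z <= r + delta.
  move=> Dy /Ar Az; have := dt y x z; rewrite (ds y x).
  by move: Dy Az; rewrite /D /cball/=; lra.
have mDA : measurable (D `*` A) by exact: measurableX.
have qDA0 : q (~` (D `*` A)) = 0%E.
  apply: (@measure_negligible _ _ _ q); first exact: measurableC.
  have mCD := measurableC mD; have mCA := measurableC mA.
  have e1 : q (~` D `*` setT) = 0%E by rewrite (qc _ mCD).1.
  have e2 : q (setT `*` ~` A) = 0%E by rewrite (qc _ mCA).2.
  have negU : q.-negligible ((~` D `*` setT) `|` (setT `*` ~` A)).
    apply: negligibleU; apply/negligibleP; [exact: measurableX|exact: e1|
      exact: measurableX|exact: e2].
  apply: negligibleS negU => -[y z] /= h.
  have [Dy|nDy] := pselect (D y); last by left.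
  by right; split => // Az; apply: h.
have qDA : q (D `*` A) = 1%E.
  have := probability_setC q mDA; rewrite qDA0.
  have : q (D `*` A) \is a fin_num by exact: fin_num_measure.
  case: (q _) => // a _ /eqP; rewrite -EFinB eqe => /eqP h; congr EFin; lra.
have mdd := measurable_dist_sqr dm sd mX.
have Wfin : W2sq d nu0 nu1 \is a fin_num.
  rewrite -qopt ge0_fin_numE; last by apply: integral_ge0 => z _; rewrite lee_fin sqr_ge0.
  rewrite (@ge0_negligible_integral _ _ _ _ setT (~` (D `*` A)))//; last 2 first.
  - exact: measurableC.
  - by move=> y _; rewrite lee_fin sqr_ge0.
  rewrite setTD setCK.
  apply: (@le_lt_trans _ _ (\int[q]_(y in D `*` A) (cst ((r + delta) ^+ 2)%:E) y)%E).
    apply: ge0_le_integral => //.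
    - by move=> y _; rewrite lee_fin sqr_ge0.
    - exact: measurable_funTS.
    - move=> [y z] [Dy Az]; rewrite lee_fin ler_pXn2r ?nnegrE ?DAL//.
      by rewrite addr_ge0// ltW.
  by rewrite integral_cst// [X in (_ * X)%E]qDA mule1 ltry.
pose w := fine (W2sq d nu0 nu1).
have wE : W2sq d nu0 nu1 = w%:E by rewrite fineK.
have I0 : 0 <= (0 : R) <= 1 by rewrite lexx ler01.
have I1 : 0 <= (1 : R) <= 1 by rewrite lexx ler01.
have It : 0 <= t <= 1 by rewrite !ltW.
have w0E : W2sq d nu0 (Gt t) = (t ^+ 2 * w)%:E.
  have := Gspeed _ _ I0 It; rewrite wE sub0r sqrrN => h; rewrite EFinM -h.
  by apply: W2sq_eq => // C mC; rewrite (Gend _ mC).1.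
have w1E : W2sq d (Gt t) nu1 = ((1 - t) ^+ 2 * w)%:E.
  have := Gspeed _ _ It I1; rewrite wE -opprB sqrrN => h; rewrite EFinM -h.
  by apply: W2sq_eq => // C mC; rewrite (Gend _ mC).2.
(* This is where the radius [t r + 3 delta] comes from: a point outside [B] is farther than
   [t r + 2 delta] from each point of [D], and this is at least [t (r + delta) + delta] because
   [t < 1]. *)
have GtB : Gt t (~` B) = 0%E.
  apply: (@interpolation_support _ _ _ d dm sd mX nu0 (Gt t) nu1 D A (~` B)
    t (r + delta) delta w) => //.
  - exact: measurableC.
  - move=> y z Dy /= /negP; rewrite -ltNge => Bz.
    have := dt x y z; move: Dy; rewrite /D /cball/= => Dy.
    by nra.
have N1 : 1 < n%:R :> R by rewrite ltr1n.
have muB : mu B = (fine (mu B))%:E by rewrite fineK.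
have := renyi_le_support N1 mB muB v0 GtB (ren t n%:R It (lexx _)).
set F := (F in (\int[q]_z F z)%E) => hF.
have iN : 0 < n%:R^-1 :> R by rewrite invr_gt0; lra.
have c0 : 0 <= t * (1 - t ^+ 2) * G `^ n%:R^-1.
  by rewrite !mulr_ge0 ?powR_ge0 ?(ltW t0)// subr_ge0 exprn_ile1// ltW.
have : ((t * (1 - t ^+ 2) * G `^ n%:R^-1)%:E * q (D `*` A) <= \int[q]_z F z)%E.
  apply: ge0_integral_ge_indic => //.
  - by move=> z; rewrite /F adde_ge0// mule_ge0// ?tauKN_ge0// lee_fin powR_ge0.
  move=> [y z] [Dy Az]; rewrite /F /=.
  (* The term with [rho0] is nonnegative and is dropped; only the target density contributes to the
     bound. *)
  apply: (@le_trans _ _ (tauKN kappa n%:R (d y z) t * (rho1 z `^ (- n%:R^-1))%:E)%E); last first.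
    by rewrite leeDr// mule_ge0// ?tauKN_ge0// lee_fin powR_ge0.
  have thle : kappa * d y z ^+ 2 <= 1.
    apply: le_trans krd; rewrite ler_wpM2l// ler_pXn2r ?nnegrE ?DAL//.
    by rewrite addr_ge0// ltW.
  have [s -> hs] := tauKN_ge n2 kappa0 (d0 y z) thle t01.
  rewrite -EFinM lee_fin.
  have rz : rho1 z = G^-1 * gd x delta z by rewrite /rho1 indicE mem_set// mulr1.
  have gz0 : 0 < gd x delta z by rewrite (lt_le_trans ltr01).
  rewrite rz powRM ?(ltW Gi0) ?(ltW gz0)// -[G^-1]powR_inv1 ?(ltW G0)// -powRrM mulrNN mul1r.
  have gle : gd x delta z `^ n%:R^-1 <= (1 + kappa * d y z ^+ 2 / 6) `^ n%:R^-1.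
    apply: ge0_ler_powR; first exact: ltW.
    - by rewrite nnegrE ltW.
    - by rewrite nnegrE addr_ge0// divr_ge0// mulr_ge0// sqr_ge0.
    - rewrite /ball_weight lerD2l mulrAC ler_pM2r ?invr_gt0// ler_wpM2l//.
      rewrite ler_pXn2r ?nnegrE ?le_max ?lexx ?orbT//.
      rewrite ge_max d0 andbT; have := dt x y z; move: Dy; rewrite /D /cball/=; lra.
  have gp0 : 0 < gd x delta z `^ n%:R^-1 by rewrite powR_gt0.
  rewrite powRN mulrA ler_pdivlMr// mulrAC ler_wpM2r ?powR_ge0//.
  apply: le_trans hs; rewrite ler_wpM2l// mulr_ge0 ?(ltW t0)//.
  by rewrite subr_ge0 exprn_ile1// ltW.
rewrite qDA mule1 => hG; have {hG} := le_trans hG hF.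
rewrite lee_fin => hG.
have : (t * (1 - t ^+ 2) * G `^ n%:R^-1) ^+ n <= (fine (mu B) `^ n%:R^-1) ^+ n.
  by rewrite ler_pXn2r ?nnegrE// ?powR_ge0// (leq_trans _ n2).
have rootK (a : R) : 0 <= a -> (a `^ n%:R^-1) ^+ n = a.
  by move=> a0; rewrite -powR_mulrn ?powR_ge0// -powRrM mulVf ?powRr1// gt_eqF// (lt_trans ltr01).
rewrite exprMn !rootK ?(ltW G0) ?(ltW v0)// => h.
rewrite muB -(fineK Gfin) -EFinM lee_fin; apply: le_trans h.
by rewrite /G.
Qed.

End ball_inequality.

(** Allows the one-sided limit in [n_dimensional] to be taken along positive radii [h t] shrinking
    to 0. *)
Lemma at_right0_comp (R : realType) (h : R -> R) : {for 0, continuous h} -> h 0 = 0 ->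
  (forall t, 0 < t -> 0 < h t) -> h t @[t --> 0^'+] --> 0^'+.
Proof.
move=> ch h0 hp P [e /= e0 He].
have ch' : h t @[t --> 0^'+] --> 0.
  by rewrite -[X in _ --> X]h0; exact: cvg_at_right_filter.
move/cvgrPdist_lt : (ch') => /(_ _ e0) nr.
suff : \forall t \near 0^'+, P (h t) by [].
near=> t.
have ht : 0 < h t by apply: hp; near: t; exact: nbhs_right_gt.
apply: (He (h t) _ ht).
by near: t; exact: nr.
Unshelve. all: by end_near. Qed.

(** * The weighted Bishop inequality in the limit of small times *)

Section weighted_ball.
Context (dX : measure_display) (X : measurableType dX) (R : realType).
Context (d : X -> X -> R) (mu : {measure set X -> \bar R}) (n : nat) (kappa : R).
Context (n2 : (2 <= n)%N) (kappa0 : 0 <= kappa) (mm : mm_space d mu)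
  (nd : n_dimensional n d mu) (cd : CD d mu kappa n%:R).

Let dm : is_metric d. Proof. by case: mm. Qed.
Let sd : d_separable d. Proof. by case: mm. Qed.
Let mX : (@measurable _ X : set (set X)) = <<s [set A | d_open d A] >>.
Proof. by case: mm => _ _ _ _ []. Qed.

(** Among the balls of radius [1/(k+1)] about a dense sequence, those of finite measure are kept and
    the others replaced by the empty set. They still cover: near [x], a ball with [1/(k+1) < r/2]
    that contains [x] lies inside a finite ball of radius [r]. *)
Lemma mm_space_sigma_finite : X -> sigma_finite setT mu.
Proof.
move=> x0; have [d0 d00 ds dt] := dm.
have [u du] := countable_dense_seq x0 sd.
have lf : forall x : X, exists2 r : R, 0 < r & (mu (oball d x r) < +oo)%E.
  by case: mm => _ _ _ _ [].
pose V (p : nat * nat) : set X :=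
  if pselect (mu (oball d (u p.1) p.2.+1%:R^-1) < +oo)%E
  then oball d (u p.1) p.2.+1%:R^-1 else set0.
exists (fun j => if unpickle j is Some p then V p else set0).
  apply/seteqP; split => // x _.
  have [r r0 roo] := lf x.
  have r20 : 0 < r / 2 by lra.
  have [k] := ltr_add_invr r20; rewrite add0r => kr.
  have [i xi] := du x k.+1%:R^-1 ltac:(by rewrite invr_gt0).
  exists (pickle (i, k)) => //; rewrite pickleK /V/=.
  case: pselect => [h|]; first by rewrite /oball/= ds.
  case; apply: le_lt_trans roo; apply: le_measure; rewrite ?inE; try exact: measurable_oball.
  move=> y; rewrite /oball/= => h; have := dt x (u i) y.
  by move: kr xi h; move: (k.+1%:R^-1) => e; lra.
move=> j; case: (unpickle j) => [p|]; last by rewrite measure0.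
rewrite /V; case: pselect => h /=; last by rewrite measure0.
by split => //; exact: measurable_oball.
Qed.

(** As [fine] sends an infinite measure to 0, a density ratio above 1/2 excludes both measure 0 and
    infinite measure. *)
Lemma near_ball_finite (x : X) :
  \forall r \near 0^'+, (0 < mu (cball d x r) < +oo)%E.
Proof.
have := @nd x => /(cvgr_gt (1 : R)) /(_ (1 / 2)) h.
have {}h : \forall r \near 0^'+, 1 / 2 < fine (mu (cball d x r)) / volE n r.
  by apply: h; lra.
near=> r.
have : 1 / 2 < fine (mu (cball d x r)) / volE n r by near: r.
have r0 : 0 < r by near: r; exact: nbhs_right_gt.
have v0 : 0 < volE n r by rewrite mulr_gt0 ?omega_gt0 ?exprn_gt0.
have : (0 <= mu (cball d x r))%E by [].
case: (mu _) => [s||]//=.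
  rewrite !lte_fin lee_fin ltry andbT => s0 h1.
  rewrite lt_neqAle s0 andbT; apply/eqP => s00; move: h1; rewrite -s00 mul0r; lra.
by move=> _; rewrite mul0r => h1; exfalso; lra.
Unshelve. all: by end_near. Qed.

Lemma measurable_weight x : measurable_fun setT (fun y => 1 + kappa / 6 * d x y ^+ 2).
Proof.
apply: measurable_funD => //; apply: measurable_funM => //.
by apply: measurable_funX; exact: measurable_dist_l.
Qed.

Lemma weight_ge1 x y : 1 <= 1 + kappa / 6 * d x y ^+ 2.
Proof. by rewrite lerDl mulr_ge0// ?divr_ge0// sqr_ge0. Qed.

(** [ball_inequality] is used with [delta = t^2], divided by [t^n], and passed to the limit
    [t -> 0]. Finiteness of [mu A] is assumed because [ball_inequality] asks for it; balls are
    reached afterwards by exhaustion. *)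
Lemma weighted_ball_le_fin (x : X) (A : set X) (r : R) :
  0 < r -> kappa * (2 * r) ^+ 2 <= 1 ->
  measurable A -> A `<=` cball d x r -> (mu A < +oo)%E ->
  (\int[mu]_(y in A) (1 + kappa / 6 * d x y ^+ 2)%:E <= (volE n r)%:E)%E.
Proof.
move=> r0 kr mA Ar Aoo.
have [d0 d00 ds dt] := dm.
set Int := (\int[mu]_(y in A) _)%E.
set c := kappa / 6.
have c0 : 0 <= c by rewrite divr_ge0.
have mwA : measurable_fun A (fun y => (1 + kappa / 6 * d x y ^+ 2)%:E).
  by apply/measurable_EFinP; apply: measurable_funTS; exact: measurable_weight.
have Iub : (Int <= (1 + c * r ^+ 2)%:E * mu A)%E.
  rewrite -integral_cst//; apply: ge0_le_integral => //.
  - by move=> y _; rewrite lee_fin (le_trans ler01)// weight_ge1.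
  - move=> y Ay; rewrite lee_fin lerD2l ler_wpM2l// ler_pXn2r ?nnegrE ?(ltW r0)//.
    exact: Ar.
have om0 : 0 < omega n :> R := omega_gt0 R n.
have [A0|A0] := eqVneq (mu A) 0%E.
  apply: (le_trans Iub); rewrite A0 mule0 lee_fin mulr_ge0 ?(ltW om0)//.
  by rewrite exprn_ge0// ltW.
have A0' : (0 < mu A)%E by rewrite lt_neqAle eq_sym A0 measure_ge0.
have Afin : mu A \is a fin_num by rewrite ge0_fin_numE.
have I0 : (0 <= Int)%E.
  by apply: integral_ge0 => y _; rewrite lee_fin (le_trans ler01)// weight_ge1.
have Ifin : Int \is a fin_num.
  by rewrite ge0_fin_numE// (le_lt_trans Iub)// ltey_eq fin_numM.
pose I := fine Int; pose m := fine (mu A).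
have IE : Int = I%:E by rewrite fineK.
have mE : mu A = m%:E by rewrite fineK.
rewrite IE lee_fin.
pose phi s := fine (mu (cball d x s)) / volE n s.
(* The radius from [ball_inequality] at [delta = t^2]. It equals [t (r + 3 t)], so the enlargement
   is of lower order after division by [t]. *)
pose rho t : R := t * r + 3 * t ^+ 2.
have sqc (t : R) : {for t, continuous (fun t : R => t ^+ 2)} by exact: exprn_continuous.
have rhoc (t : R) : {for t, continuous rho}.
  apply: cvgD; first by apply: cvgM; [exact: cvg_id|exact: cvg_cst].
  by apply: cvgM; [exact: cvg_cst|exact: sqc].
have sq0 : t ^+ 2 @[t --> (0 : R)^'+] --> (0 : R)^'+.
  apply: at_right0_comp; [exact: sqc|by rewrite expr0n|].
  by move=> t t0; rewrite exprn_gt0.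
have rho0 : rho t @[t --> 0^'+] --> 0^'+.
  apply: at_right0_comp; [exact: rhoc|by rewrite /rho; ring|].
  by move=> t t0; rewrite addr_gt0 ?mulr_gt0 ?exprn_gt0.
have cvgphi : (phi \o rho) t @[t --> 0^'+] --> (1 : R).
  by apply: (cvg_comp rho phi rho0); exact: (@nd x).
(* [fl] and [fr] are the two sides divided by [t^n]. The term [2 c r t^2 m] in [fl] bounds the total
   loss from truncating the weight, [m] being the mass of [A]. *)
pose fl t := (1 - t ^+ 2) ^+ n * (I - 2 * c * r * t ^+ 2 * m).
pose fr t := phi (rho t) * (omega n * (r + 3 * t) ^+ n).
have cvgl : fl t @[t --> 0^'+] --> I.
  have -> : I = fl 0 by rewrite /fl expr0n/= subr0 expr1n !(mulr0, mul0r) subr0 mul1r.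
  apply: cvg_at_right_filter; apply: cvgM.
    apply: (@continuous_comp R R R (fun t => 1 - t ^+ 2) (fun y => y ^+ n)).
      by apply: cvgB; [exact: cvg_cst|exact: sqc].
    exact: exprn_continuous.
  apply: cvgB; first exact: cvg_cst.
  apply: cvgM; last exact: cvg_cst.
  by apply: cvgM; [exact: cvg_cst|exact: sqc].
have cvgr : fr t @[t --> 0^'+] --> volE n r.
  have -> : volE n r = 1 * (omega n * (r + 3 * 0) ^+ n) by rewrite mulr0 addr0 mul1r.
  apply: cvgM => //; apply: cvgM; first exact: cvg_cst.
  apply: (@cvg_at_right_filter _ _ (fun t : R => (r + 3 * t) ^+ n) 0).
  apply: (@continuous_comp R R R (fun t => r + 3 * t) (fun y => y ^+ n)).
    apply: cvgD; first exact: cvg_cst.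
    by apply: cvgM; [exact: cvg_cst|exact: cvg_id].
  exact: exprn_continuous.
apply: (ler_cvg_to cvgl cvgr).
have nearsq := sq0 _ (near_ball_finite x).
have nearrho := rho0 _ (near_ball_finite x).
near=> t.
have t0 : 0 < t by near: t; exact: nbhs_right_gt.
have t1 : t < 1 by near: t; exact: nbhs_right_lt.
have tr : t < r by near: t; exact: nbhs_right_lt.
have t20 : 0 < t ^+ 2 by rewrite exprn_gt0.
have t2r : t ^+ 2 <= r by rewrite expr2; nra.
have hD : (0 < mu (cball d x (t ^+ 2)) < +oo)%E by near: t; exact: nearsq.
have hB : (0 < mu (cball d x (rho t)) < +oo)%E by near: t; exact: nearrho.
have t01 : 0 < t < 1 by rewrite t0 t1.
have krd : kappa * (r + t ^+ 2) ^+ 2 <= 1.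
  apply: le_trans kr; rewrite ler_wpM2l// ler_pXn2r ?nnegrE//; lra.
have hA : (0 < mu A < +oo)%E by rewrite A0' Aoo.
have := ball_inequality n2 kappa0 mm cd r0 t20 t01 krd mA Ar hA hD.
rewrite -/(rho t).
have Bfin : mu (cball d x (rho t)) \is a fin_num.
  by rewrite ge0_fin_numE//; case/andP: hB.
have mgA : measurable_fun A (fun y => (ball_weight d kappa x (t ^+ 2) y)%:E).
  apply/measurable_EFinP; apply: measurable_funTS.
  exact: (measurable_ball_weight kappa mm).
set Gam := (\int[mu]_(y in A) (ball_weight d kappa x (t ^+ 2) y)%:E)%E => hG.
have hI : ((I - 2 * c * r * t ^+ 2 * m)%:E <= Gam)%E.
  rewrite EFinB leeBlDr// -IE EFinM -mE -integral_cst// -ge0_integralD//; last 2 first.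
  - by move=> y _; rewrite lee_fin (le_trans ler01)// ball_weight_ge1.
  - by move=> y _; rewrite lee_fin !mulr_ge0// ltW.
  apply: ge0_le_integral => //.
  - by move=> y _; rewrite lee_fin (le_trans ler01)// weight_ge1.
  - exact: emeasurable_funD.
  move=> y Ay; rewrite -EFinD lee_fin /ball_weight -/c.
  have dr : d x y <= r by exact: Ar.
  have dy0 := d0 x y.
  (* For [z = d x y <= r] and [delta = t^2 <= r], replacing [z] by its truncation costs at most
     [2 r delta] in the square. *)
  suff : d x y ^+ 2 <= Num.max (d x y - t ^+ 2) 0 ^+ 2 + 2 * r * t ^+ 2.
    by move=> h; have := ler_wpM2l c0 h; lra.
  move: (t ^+ 2) (d x y) dr dy0 t20 t2r => dl z zr z0 dl0 dlr.
  have [zd|zd] := leP (z - dl) 0; first by rewrite expr0n/= add0r; nra.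
  by nra.
have tn0 : 0 < t ^+ n by rewrite exprn_gt0.
have cn0 : 0 <= (t * (1 - t ^+ 2)) ^+ n.
  by rewrite exprn_ge0// mulr_ge0 ?(ltW t0)// subr_ge0 exprn_ile1// ltW.
have : (((t * (1 - t ^+ 2)) ^+ n)%:E * (I - 2 * c * r * t ^+ 2 * m)%:E <=
    (fine (mu (cball d x (rho t))))%:E)%E.
  rewrite fineK//; apply: le_trans hG; apply: lee_wpmul2l => //.
rewrite -EFinM lee_fin exprMn.
have -> : t ^+ n * (1 - t ^+ 2) ^+ n * (I - 2 * c * r * t ^+ 2 * m) = t ^+ n * fl t.
  by rewrite /fl mulrA.
have -> : fine (mu (cball d x (rho t))) = t ^+ n * fr t.
  have rt0 : 0 < r + 3 * t by lra.
  have rhoE : rho t = t * (r + 3 * t) by rewrite /rho; ring.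
  rewrite /fr /phi /volE {3}rhoE exprMn.
  set q := (r + 3 * t) ^+ n; have q0 : 0 < q by rewrite exprn_gt0.
  set f := fine _; field.
  by rewrite !gt_eqF.
by rewrite ler_pM2l.
Unshelve. all: by end_near. Qed.

(** The ball is not yet known to have finite measure, so it is exhausted by pieces of finite
    measure. Each piece obeys the bound because the weight is at least 1, and continuity from below
    concludes. *)
Lemma ball_le_volE (x : X) (r : R) : 0 < r -> kappa * (2 * r) ^+ 2 <= 1 ->
  (mu (cball d x r) <= (volE n r)%:E)%E.
Proof.
move=> r0 kr.
have /sigma_finiteP[F [TF ndF Ffin]] := mm_space_sigma_finite x.
have mB : measurable (cball d x r) by exact: measurable_cball.
pose E k := cball d x r `&` F k.
have mE k : measurable (E k) by apply: measurableI => //; case: (Ffin k).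
have UE : \bigcup_k E k = cball d x r by rewrite -setI_bigcupr -TF setIT.
have hE k : (mu (E k) <= (volE n r)%:E)%E.
  have Eoo : (mu (E k) < +oo)%E.
    have [mFk Fk] := Ffin k; apply: le_lt_trans Fk.
    by apply: le_measure; rewrite ?inE// => y [].
  apply: le_trans (@weighted_ball_le_fin x (E k) r r0 kr (mE k) _ Eoo); last by move=> y [].
  rewrite -[leLHS]mul1e -integral_cst//; apply: ge0_le_integral => //.
  - by apply/measurable_EFinP; apply: measurable_funTS; exact: measurable_weight.
  - by move=> y _; rewrite lee_fin weight_ge1.
have cv := @nondecreasing_cvg_mu _ _ _ mu E mE.
rewrite UE in cv.
have {}cv : mu \o E @ \oo --> mu (cball d x r).
  apply: cv => // i j ij; apply/subsetPset; apply: setIS.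
  by apply/subsetPset; exact: ndF.
rewrite -(cvg_lim _ cv)//; apply: lime_le; first by apply/cvg_ex; eexists; exact: cv.
by apply: nearW => k; exact: hE.
Qed.

Lemma weighted_ball_le (x : X) (r : R) : 0 < r -> kappa * (2 * r) ^+ 2 <= 1 ->
  (\int[mu]_(y in cball d x r) (1 + kappa / 6 * d x y ^+ 2)%:E <= (volE n r)%:E)%E.
Proof.
move=> r0 kr; apply: weighted_ball_le_fin => //; first exact: measurable_cball.
by apply: le_lt_trans (ball_le_volE x r0 kr) _; rewrite ltry.
Qed.

End weighted_ball.

(** * Layer cake formula and the second order volume bound *)

Lemma integral_mfrestr (dX : measure_display) (X : measurableType dX)
    (R : realType) (mu : {measure set X -> \bar R}) (B : set X)
    (mB : measurable B) (Boo : (mu B < +oo)%E) (g : X -> \bar R) :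
  measurable_fun setT g -> (forall y, 0 <= g y)%E ->
  (\int[mfrestr mB Boo]_y g y = \int[mu]_(y in B) g y)%E.
Proof.
move=> mg g0.
rewrite (@ge0_negligible_integral _ _ _ _ setT (~` B))//; last 2 first.
- exact: measurableC.
- have h0 : mu (~` B `&` B) = 0%E by rewrite setICl measure0.
  exact: h0.
rewrite setTD setCK; apply: eq_measure_integral => A mA AB.
have h1 : mu (A `&` B) = mu A by rewrite setIidl.
exact: h1.
Qed.

Lemma integral_exprn (R : realType) (a b : R) (k : nat) : a < b ->
  (\int[@lebesgue_measure R]_(u in `[a, b]%classic) ((k.+1%:R * u ^+ k)%R)%:E =
   (b ^+ k.+1 - a ^+ k.+1)%:E)%E.
Proof.
move=> ab; rewrite EFinB.
apply: (@continuous_FTC2 R (fun u => k.+1%:R * u ^+ k) (fun u => u ^+ k.+1)) => //.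
- apply: continuous_subspaceT => s; apply: cvgM; first exact: cvg_cst.
  exact: exprn_continuous.
- split.
  + by move=> s _; exact: exprn_derivable.
  + by apply: cvg_at_right_filter; exact: exprn_continuous.
  + by apply: cvg_at_left_filter; exact: exprn_continuous.
- by move=> s _; rewrite exp_derive1.
Qed.

Section layer_cake.
Context (dX : measure_display) (X : measurableType dX) (R : realType).
Context (d : X -> X -> R) (mu : {measure set X -> \bar R}).
Context (dm : is_metric d).
Context (mX : (@measurable _ X : set (set X)) = <<s [set A | d_open d A] >>).

(** Writing [r^2 - d^2] as the integral of [2 u] for [u] from [d] to [r] and exchanging integrals by
    Tonelli leaves the integral over [[0, r]] of [2 u] times the measure of the [u]-ball, which is
    at most [2 om u^(n+1)]. *)
Lemma layer_cake_ball (x : X) (r om : R) (n : nat) : 0 < r -> 0 <= om ->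
  (forall u, 0 < u <= r -> (mu (cball d x u) <= (om * u ^+ n)%:E)%E) ->
  (\int[mu]_(y in cball d x r) (r ^+ 2 - d x y ^+ 2)%:E <=
    (2 * om * r ^+ n.+2 / n.+2%:R)%:E)%E.
Proof.
move=> r0 om0 hom; have [d0 d00 ds dt] := dm.
set B := cball d x r.
have mB : measurable B by exact: measurable_cball.
have Boo : (mu B < +oo)%E.
  by apply: (@le_lt_trans _ _ (om * r ^+ n)%:E); rewrite ?ltry// hom// r0 lexx.
(* Restriction to the ball gives the finite measure to which Tonelli is applied. *)
pose m1 : {finite_measure set X -> \bar R} := mfrestr mB Boo.
pose J := `[0, r]%classic : set R.
pose E := [set z : X * R | d x z.1 <= z.2].
pose f (z : X * R) : \bar R := (2 * z.2 * \1_J z.2 * \1_E z)%:E.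
(* Truncation at 0 makes the identity with the inner integral valid on all of [X], where the
   interval from [d x y] to [r] may be empty. *)
pose g y := Num.max (r ^+ 2 - d x y ^+ 2) 0.
have mdx := measurable_dist_l dm mX x.
have mE : measurable E.
  have mb : measurable_fun setT (fun z : X * R => d x z.1 <= z.2).
    by apply: measurable_fun_ler => //; exact: measurableT_comp.
  rewrite -[X in measurable X]setTI.
  rewrite (_ : E = (fun z : X * R => d x z.1 <= z.2) @^-1` [set true]); first exact: mb.
  by apply/seteqP; split => z /=.
have mJ : measurable J by exact: measurable_itv.
have mf : measurable_fun setT f.
  apply/measurable_EFinP; apply: measurable_funM; last exact: measurable_indic.
  apply: measurable_funM; first exact: measurable_funM.
  by apply: measurableT_comp => //; exact: measurable_indic.
have f0 z : (0 <= f z)%E.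
  rewrite lee_fin indicE; have [zJ|zJ] := boolP (z.2 \in J); last by rewrite mulr0 mul0r.
  by rewrite mulr1 mulr_ge0// mulr_ge0//; move: zJ; rewrite inE /J/= in_itv/= => /andP[].
have FT := @fubini_tonelli _ _ _ _ _ m1 (@lebesgue_measure R) f mf f0.
have inner1 y : (\int[@lebesgue_measure R]_u f (y, u) = (g y)%:E)%E.
  transitivity (\int[@lebesgue_measure R]_(u in `[d x y, r]%classic) (2%:R * u ^+ 1)%:E)%E.
    rewrite [RHS]integral_mkcond; apply: eq_integral => u _.
    rewrite patchE /f/= !indicE expr1 /J /E.
    have [uI|uI] := boolP (u \in `[d x y, r]%classic).
      move: uI; rewrite inE/= in_itv/= => /andP[u1 u2].
      rewrite mem_set ?mem_set ?mulr1//=.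
      by rewrite in_itv/= u2 (le_trans (d0 x y) u1).
    have [uJ|uJ] := boolP (u \in `[0, r]%classic); last by rewrite mulr0 mul0r.
    have [du|du] := boolP ((y, u) \in _); last by rewrite mulr0.
    exfalso; move/negP: uI; apply; move: uJ du; rewrite !inE/= !in_itv/=.
    by move=> /andP[_ ->] ->.
  rewrite /g; have [yr|yr|yr] := ltgtP (d x y) r.
  - rewrite integral_exprn//; congr EFin; apply/esym/max_idPl.
    by rewrite subr_ge0 ler_pXn2r ?nnegrE ?(ltW yr) ?(ltW r0).
  - have -> : `[d x y, r]%classic = set0 :> set R.
      apply/seteqP; split => u //=; rewrite in_itv/= => /andP[u1 u2].
      by move: (le_trans u1 u2); rewrite leNgt yr.
    rewrite integral_set0.
    congr EFin; apply/esym/max_idPr.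
    by rewrite subr_le0 ler_pXn2r ?nnegrE ?(ltW yr) ?(ltW r0).
  - by rewrite yr set_itv1 integral_set1 subrr maxxx.
have inner2 u : (\int[m1]_y f (y, u) <= ((2 * om * u ^+ n.+1) * \1_J u)%:E)%E.
  rewrite /f/=; have [uJ|uJ] := boolP (u \in J); last first.
    rewrite (eq_integral (cst 0%E)); last by move=> y _; rewrite indicE (negbTE uJ) mulr0 mul0r.
    by rewrite integral0 indicE (negbTE uJ) mulr0.
  rewrite [\1_J u]indicE uJ/= !mulr1.
  have /andP[u0 ur] : 0 <= u <= r by move: uJ; rewrite inE /J/= in_itv.
  (* The radius 0 is treated apart, since [hom] covers positive radii only; there the factor [2 u]
     vanishes. *)
  move: u0; rewrite le_eqVlt => /predU1P[<-|u0].
    rewrite (eq_integral (cst 0%E)); last by move=> y _; rewrite !(mulr0, mul0r).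
    by rewrite integral0 expr0n/= !(mulr0, mul0r).
  have mBu : measurable (cball d x u) by exact: measurable_cball.
  rewrite (eq_integral (fun y => ((2 * u)%:E * (\1_(cball d x u) y)%:E)%E)); last first.
    by move=> y _; rewrite -EFinM; congr (_ * _)%:E; rewrite !indicE; congr (_%:R).
  rewrite ge0_integralZl_EFin//; last 2 first.
  - by apply/measurable_EFinP; exact: measurable_indic.
  - by rewrite mulr_ge0// ltW.
  rewrite integral_indic// setIT.
  have hm : (m1 (cball d x u) <= (om * u ^+ n)%:E)%E.
    apply: le_trans (hom u _); last by rewrite u0.
    exact: measureIl.
  have -> : ((2 * om * u ^+ n.+1)%:E = (2 * u)%:E * (om * u ^+ n)%:E)%E.
    by rewrite -EFinM exprS; congr EFin; ring.
  by apply: lee_wpmul2l => //; rewrite lee_fin mulr_ge0// ltW.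
have -> : (\int[mu]_(y in B) (r ^+ 2 - d x y ^+ 2)%:E = \int[mu]_(y in B) (g y)%:E)%E.
  apply: eq_integral => y; rewrite inE /B /cball/= => yr; congr EFin.
  apply/esym/max_idPl; by rewrite subr_ge0 ler_pXn2r ?nnegrE ?(ltW r0).
have mg : measurable_fun setT (fun y => (g y)%:E).
  apply/measurable_EFinP; apply: measurable_maxr => //; apply: measurable_funB => //.
  exact: measurable_funX.
rewrite -(integral_mfrestr mB Boo mg); last first.
  by move=> y; rewrite lee_fin le_max lexx orbT.
have -> : (\int[mfrestr mB Boo]_y (g y)%:E =
    \int[m1]_y \int[@lebesgue_measure R]_u f (y, u))%E.
  by apply: eq_integral => y _; rewrite inner1.
rewrite FT.
apply: (@le_trans _ _ (\int[@lebesgue_measure R]_u ((2 * om * u ^+ n.+1) * \1_J u)%:E)%E).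
  apply: ge0_le_integral => //.
  - by move=> u _; exact: integral_ge0.
  - exact: (@measurable_fun_fubini_tonelli_G _ _ _ _ _ m1 f mf f0).
  - apply/measurable_EFinP; apply: measurable_funM; last exact: measurable_indic.
    by apply: measurable_funM => //; exact: measurable_funX.
have -> : (\int[@lebesgue_measure R]_u ((2 * om * u ^+ n.+1) * \1_J u)%:E =
   \int[@lebesgue_measure R]_(u in J) ((2 * om / n.+2%:R)%:E * (n.+2%:R * u ^+ n.+1)%:E))%E.
  rewrite [RHS]integral_mkcond; apply: eq_integral => u _.
  rewrite patchE indicE; case: ifPn => _; rewrite ?mulr0// mulr1 -EFinM; congr EFin.
  rewrite mulrA divfK// pnatr_eq0//.
rewrite ge0_integralZl_EFin//; last 3 first.
- move=> u; rewrite /J/= in_itv/= => /andP[u0 _].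
  by rewrite lee_fin mulr_ge0// exprn_ge0.
- apply/measurable_EFinP; apply: measurable_funTS.
  by apply: measurable_funM => //; exact: measurable_funX.
- by rewrite divr_ge0// mulr_ge0.
rewrite integral_exprn// expr0n/= subr0 -EFinM lee_fin.
by rewrite le_eqVlt; apply/orP; left; apply/eqP; rewrite mulrAC.
Qed.

End layer_cake.

(** On the ball, with [c = kappa/6], the constant [1 + c r^2] is the weight [1 + c d^2] plus
    [c (r^2 - d^2)]. The weighted Bishop inequality bounds the integral of the first and the layer
    cake estimate that of the second. *)
Lemma ball_volume_bound (dX : measure_display) (X : measurableType dX)
  (R : realType) (d : X -> X -> R) (mu : {measure set X -> \bar R})
  (n : nat) (kappa : R) (x : X) (r : R) :
  (2 <= n)%N -> 0 <= kappa -> mm_space d mu -> n_dimensional n d mu ->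
  CD d mu kappa n%:R -> 0 < r -> kappa * (2 * r) ^+ 2 <= 1 ->
  (mu (cball d x r) <= (volE n r * (1 + kappa * r ^+ 2 / (3 * (n%:R + 2))) /
     (1 + kappa * r ^+ 2 / 6))%:E)%E.
Proof.
move=> n2 k0 mm nd cd r0 kr.
have [dm _ sd _ [mX _ _]] := mm; have [d0 _ _ _] := dm.
set B := cball d x r.
have mB : measurable B by exact: measurable_cball.
have om0 : 0 < omega n :> R := omega_gt0 R n.
have hB u : 0 < u <= r -> (mu (cball d x u) <= (omega n * u ^+ n)%:E)%E.
  move=> /andP[u0 ur]; apply: (ball_le_volE n2 k0 mm nd cd) => //.
  apply: le_trans kr; rewrite ler_wpM2l// ler_pXn2r ?nnegrE//; lra.
have hJ := layer_cake_ball dm mX r0 (ltW om0) hB.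
have hI := weighted_ball_le n2 k0 mm nd cd x r0 kr.
have Bfin : mu B \is a fin_num.
  rewrite ge0_fin_numE//; apply: le_lt_trans (hB r _) _; rewrite ?ltry// r0 lexx//.
have mw := measurable_weight kappa mm x.
have mdx := measurable_dist_l dm mX x.
have c0 : 0 <= kappa / 6 by rewrite divr_ge0.
have mJ : measurable_fun B (fun y => (r ^+ 2 - d x y ^+ 2)%:E).
  apply/measurable_EFinP; apply: measurable_funTS; apply: measurable_funB => //.
  exact: measurable_funX.
have J0 y : B y -> 0 <= r ^+ 2 - d x y ^+ 2.
  by rewrite /B /cball/= => yr; rewrite subr_ge0 ler_pXn2r ?nnegrE ?(ltW r0).
have split_int : ((1 + kappa / 6 * r ^+ 2)%:E * mu B =
  \int[mu]_(y in B) (1 + kappa / 6 * d x y ^+ 2)%:E +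
  (kappa / 6)%:E * \int[mu]_(y in B) (r ^+ 2 - d x y ^+ 2)%:E)%E.
  rewrite -integral_cst// -ge0_integralZl_EFin// -ge0_integralD//.
  - by apply: eq_integral => y _; rewrite -EFinM -EFinD; congr EFin; ring.
  - by move=> y _; rewrite lee_fin (le_trans ler01)// weight_ge1.
  - by apply/measurable_EFinP; exact: measurable_funTS.
  - by move=> y By; rewrite mule_ge0 ?lee_fin// J0.
  - exact: emeasurable_funM.
have : ((1 + kappa / 6 * r ^+ 2)%:E * mu B <=
   (volE n r)%:E + (kappa / 6)%:E * (2 * omega n * r ^+ n.+2 / n.+2%:R)%:E)%E.
  by rewrite split_int; apply: leeD => //; exact: lee_wpmul2l.
rewrite -(fineK Bfin) -!EFinM -EFinD !lee_fin => h.
have q0 : 0 < 1 + kappa * r ^+ 2 / 6.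
  by rewrite ltr_pwDl// divr_ge0// mulr_ge0// sqr_ge0.
rewrite ler_pdivlMr// mulrC; apply: le_trans (le_trans _ h) _.
  by rewrite le_eqVlt; apply/orP; left; apply/eqP; congr (_ * _); field.
rewrite le_eqVlt; apply/orP; left; apply/eqP.
rewrite /volE !exprS -!natr1; have : 0 <= n%:R :> R by [].
by move: (n%:R) => a a0; field; lra.
Qed.

(** * Comparison of the second order terms *)

Theorem theorem2p6 (dX : measure_display) (X : measurableType dX)
  (R : realType) (d : X -> X -> R) (mu : {measure set X -> \bar R})
  (n : nat) (kappa : R) :
  (2 <= n)%N -> 0 <= kappa ->
  mm_space d mu ->
  n_dimensional n d mu ->
  CD d mu kappa n%:R ->
  Sc_vol_ge n d mu (n%:R * kappa).
Proof.
move=> n2 k0 mm nd cd.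
have n0 : 0 < n%:R :> R by rewrite ltr0n (leq_trans _ n2).
split => [nk0|nk0].
  (* With [kappa = 0] the smallness condition on the radius is void, so the volume bound holds at
     radius 1 and below. *)
  have kE : kappa = 0 by move/eqP: nk0; rewrite mulf_eq0 gt_eqF//= => /eqP.
  exists 1 => // x eps /andP[e0 e1].
  by apply: (ball_le_volE n2 k0 mm nd cd) => //; rewrite kE mul0r.
move=> gamma gam.
have kp : 0 < kappa by move: nk0; rewrite pmulr_rgt0.
have g0 : 0 < gamma by apply: le_lt_trans gam; exact: sqrtr_ge0.
have g2 : 2 / (n%:R * kappa) < gamma ^+ 2.
  have s0 : 0 <= 2 / (n%:R * kappa) by rewrite divr_ge0// ltW.
  by rewrite -[ltLHS]sqr_sqrtr// ltr_pXn2r ?nnegrE ?sqrtr_ge0// ltW.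
pose c := kappa / 6; pose a := (3 * gamma ^+ 2 * (n%:R + 2))^-1.
have g20 : 0 < gamma ^+ 2 by rewrite exprn_gt0.
have c0 : 0 < c by rewrite divr_gt0.
have a0 : 0 < a by rewrite invr_gt0 !mulr_gt0// addr_gt0.
(* The gap between the second order coefficients of the two sides once denominators are cleared. It
   is positive exactly when [2 / (n kappa) < gamma^2]. *)
pose D := c * n%:R / (n%:R + 2) - a.
have D0 : 0 < D.
  move: g2; rewrite ltr_pdivrMr// => g2.
  have -> : D = (gamma ^+ 2 * (n%:R * kappa) - 2) / (6 * gamma ^+ 2 * (n%:R + 2)).
    by rewrite /D /a /c; field; lra.
  rewrite divr_gt0 ?subr_gt0//; apply: mulr_gt0; lra.
(* The three summands give, for [eps q <= 1], in turn [eps <= 1], the smallness condition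
   [kappa (2 eps)^2 <= 1], and the control [a c eps^2 < D] of the fourth order term. *)
pose q := 1 + 4 * kappa + a * c / D.
have acD : 0 < a * c / D by rewrite divr_gt0// mulr_gt0.
have q1 : 1 <= q by rewrite /q; lra.
exists (Num.min gamma q^-1); first by rewrite lt_min g0 invr_gt0; lra.
move=> x eps /andP[e0]; rewrite le_min => /andP[eg eq].
have q0 : 0 < q by lra.
have eq1 : eps * q <= 1 by rewrite -ler_pdivlMr// mul1r.
have e1 : eps <= 1 by nra.
have e2 : eps ^+ 2 <= eps by rewrite expr2; nra.
have e20 : 0 < eps ^+ 2 by rewrite exprn_gt0.
have kr : kappa * (2 * eps) ^+ 2 <= 1.
  have -> : kappa * (2 * eps) ^+ 2 = 4 * kappa * eps ^+ 2 by ring.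
  apply: (@le_trans _ _ (4 * kappa * eps)); first by rewrite ler_wpM2l//; lra.
  apply: le_trans eq1; rewrite mulrC ler_wpM2l ?(ltW e0)// /q; lra.
have ace : a * c * eps ^+ 2 < D.
  have h : a * c / D * eps ^+ 2 < 1.
    apply: (@le_lt_trans _ _ (a * c / D * eps)); first by rewrite ler_wpM2l// ltW.
    apply: lt_le_trans eq1; rewrite mulrC ltr_pM2l// /q; lra.
  by rewrite -[ltRHS]mul1r -ltr_pdivrMr// mulrAC.
apply: (le_lt_trans (ball_volume_bound x n2 k0 mm nd cd e0 kr)).
apply: lt_le_trans (volSE_ge n2 g0 e0 eg).
rewrite lte_fin /volE.
have v0 : 0 < omega n * eps ^+ n by rewrite mulr_gt0 ?omega_gt0 ?exprn_gt0.
rewrite -mulrA ltr_pM2l//.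
have ce : 0 < 1 + kappa * eps ^+ 2 / 6.
  by rewrite ltr_pwDl// divr_ge0// mulr_ge0// ltW.
rewrite ltr_pdivrMr//.
have -> : 1 - eps ^+ 2 / (3 * gamma ^+ 2 * (n%:R + 2)) = 1 - a * eps ^+ 2.
  by rewrite /a mulrC.
have -> : kappa * eps ^+ 2 / 6 = c * eps ^+ 2 by rewrite /c; field.
have -> : kappa * eps ^+ 2 / (3 * (n%:R + 2)) = (c - c * n%:R / (n%:R + 2)) * eps ^+ 2.
  by rewrite /c; field; lra.
have -> : c * n%:R / (n%:R + 2) = D + a by rewrite /D; ring.
(* The difference of the two sides factors as [eps^2 (D - a c eps^2)], which is positive by the
   choice of [q]. *)
rewrite -subr_gt0.
have -> : (1 - a * eps ^+ 2) * (1 + c * eps ^+ 2) - (1 + (c - (D + a)) * eps ^+ 2) =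
  eps ^+ 2 * (D - a * c * eps ^+ 2) by ring.
by rewrite mulr_gt0// subr_gt0.
Qed.
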